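(* Let $q\in L^1(0,\infty)$ be real-valued and let $H^D$ be the self-adjoint operator in $L^2(0,\infty)$ given by $H^D\varphi=-\varphi''+(x+q(x))\varphi$ on the domain of $\varphi\in L^2(0,\infty)$ with $\varphi,\varphi'$ locally absolutely continuous on $[0,\infty)$, $-\varphi''+(x+q)\varphi\in L^2(0,\infty)$, and $\varphi(0)=0$. Let $\lambda_1^D<\lambda_2^D<\cdots$ be its eigenvalues (its spectrum consists of simple eigenvalues, listed increasingly). Then \[ \lambda_k^D=\left(\tfrac32\pi\big(k-\tfrac14\big)\right)^{2/3}\big(1+O(k^{-1})\big),\qquad k\to\infty. \] *)

(* Defs.v *)
From HB Require Import structures.
From mathcomp Require Import all_boot all_order all_algebra.
From mathcomp Require Import all_classical all_reals all_analysis.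
Set Implicit Arguments. Unset Strict Implicit. Unset Printing Implicit Defensive.
Import Order.TTheory GRing.Theory Num.Theory.
Import numFieldNormedType.Exports.
Local Open Scope classical_set_scope.
Local Open Scope ring_scope.

Definition abs_cont_on {R : realType} (a b : R) (f : R -> R) : Prop :=
  forall e : R, 0 < e -> exists2 d : R, 0 < d &
    forall (n : nat) (u v : 'I_n -> R),
      (forall i, a <= u i /\ u i <= v i /\ v i <= b) ->
      (forall i j, i != j -> v i <= u j \/ v j <= u i) ->
      \sum_(i < n) (v i - u i) < d ->
      \sum_(i < n) `|f (v i) - f (u i)| < e.

Definition loc_abs_cont0 {R : realType} (f : R -> R) : Prop :=
  forall b : R, 0 < b -> abs_cont_on 0 b f.

Definition L2_half {R : realType} (f : R -> R) : Prop :=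
  measurable_fun `[(0:R), +oo[ f /\
  (@lebesgue_measure R).-integrable `[(0:R), +oo[ (fun x => ((f x) ^+ 2)%:E).

Definition dirichlet_eigenvalue {R : realType} (q : R -> R) (lam : R) : Prop :=
  exists phi psi chi : R -> R,
    (loc_abs_cont0 phi /\ loc_abs_cont0 psi /\
        {ae @lebesgue_measure R, forall x : R, 0 < x -> is_derive x (1:R) phi (psi x)} /\
        {ae @lebesgue_measure R, forall x : R, 0 < x -> is_derive x (1:R) psi (chi x)} /\
        L2_half phi /\
        L2_half (fun x => - chi x + (x + q x) * phi x) /\
        {ae @lebesgue_measure R, forall x : R, 0 < x ->
            - chi x + (x + q x) * phi x = lam * phi x} /\
        phi 0 = 0 /\
        ~ {ae @lebesgue_measure R, forall x : R, 0 <= x -> phi x = 0}).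

(* Main.v *)
Require Import Defs.
From HB Require Import structures.
From mathcomp Require Import all_boot all_order all_algebra.
From mathcomp Require Import all_classical all_reals all_analysis.
From mathcomp Require Import ring lra.
Import Order.TTheory GRing.Theory Num.Theory.
Import numFieldNormedType.Exports.
Local Open Scope classical_set_scope.
Local Open Scope ring_scope.
Set Implicit Arguments. Unset Strict Implicit. Unset Printing Implicit Defensive.

(* With Q a primitive of q vanishing at infinity, the quasi-derivative u1 = u' - Q u turns
   -u'' + (x + q) u = lam u into a system with the continuous coefficient Q, and the Prufer
   angle th of (u, u1) solves a first order equation th' = F(x, th) that needs nothing but Q.
   For large x the angle band ]-pi/4, 0[ repels forward in x, so exactly one solution stays
   in it; it is the angle of the square integrable solution, and its value at 0 is minus a
   phase that is continuous and strictly increasing in lam.  Comparing Wronskians with this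
   solution shows that the eigenvalues are the points where the phase is in pi Z.
   For smooth q the Liouville-Green angle, of (s^(1/2) u, u' - u / (4 s)) with s = lam - x,
   grows like the integral of s^(1/2), i.e. by 2/3 lam^(3/2) + O(1), with an error depending on q
   only through its L^1 norm; averaging Q extends this to all integrable q.  Thus consecutive
   multiples of pi are attained at 2/3 lam_k^(3/2) = pi k + O(1). *)

(** With [q] merely integrable, an angle equation containing [q] could hold only almost everywhere.
    Trading [q] for the continuous [Q] gives classical C^1 angles, to which Picard iteration and
    pointwise barriers apply; almost-everywhere reasoning is left to the link with the operator. A
    relative error O(1/k) on the eigenvalue is a bounded additive error on 2/3 lam^(3/2), so any
    bounded loss of angle is affordable. The Liouville-Green angle is followed only up to [mu - 1],
    short of the turning point [x = mu], and the three units from there to [mu + 2] turn the angle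
    by a bounded amount. Two angles of one solution need agree only within pi. The least attained
    multiple of pi is some [n0] whose value is never computed. The width of the averages may depend
    on [mu], because the smooth bound sees only the total mass [N]. *)

Section PointwiseDerivatives.
Context {R : realType}.
Implicit Types (f g : R -> R) (x a b : R).

Lemma deq f x a b : is_derive x 1 f a -> a = b -> is_derive x 1 f b.
Proof. by move=> + <-. Qed.

Lemma dcst x (c : R) : is_derive x 1 (fun=> c) 0.
Proof. exact: is_derive_cst. Qed.

Lemma did x : is_derive x 1 (fun y : R => y) 1.
Proof. exact: is_derive_id. Qed.

Lemma dadd f g x a b : is_derive x 1 f a -> is_derive x 1 g b ->
  is_derive x 1 (fun y => f y + g y) (a + b).
Proof. by move=> ? ?; exact: is_deriveD. Qed.

Lemma dopp f x a : is_derive x 1 f a -> is_derive x 1 (fun y => - f y) (- a).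
Proof. by move=> ?; exact: is_deriveN. Qed.

Lemma dmul f g x a b : is_derive x 1 f a -> is_derive x 1 g b ->
  is_derive x 1 (fun y => f y * g y) (a * g x + f x * b).
Proof.
move=> df dg; apply: deq (is_deriveM df dg) _.
by rewrite /GRing.scale /=; ring.
Qed.

Lemma dexpn f x a n : is_derive x 1 f a ->
  is_derive x 1 (fun y => f y ^+ n.+1) (n.+1%:R * f x ^+ n * a).
Proof.
move=> df; have H := is_deriveX n.+1 df.
suff -> : (fun y => f y ^+ n.+1) = f ^+ n.+1 by apply: (deq H).
by apply/funext => y; rewrite exprfctE.
Qed.

Lemma dinv f x a : f x != 0 -> is_derive x 1 f a ->
  is_derive x 1 (fun y => (f y)^-1) (- a / (f x) ^+ 2).
Proof.
move=> f0 df; apply: (deq (is_deriveV f0 df)).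
by rewrite /GRing.scale /=; field.
Qed.

Lemma dcomp (h : R -> R) f x a b : is_derive (f x) 1 h b -> is_derive x 1 f a ->
  is_derive x 1 (fun y => h (f y)) (b * a).
Proof. by move=> dh df; exact: is_derive1_comp. Qed.

Lemma dsin f x a : is_derive x 1 f a ->
  is_derive x 1 (fun y => sin (f y)) (cos (f x) * a).
Proof. by apply: dcomp; exact: is_derive_sin. Qed.

Lemma dcos f x a : is_derive x 1 f a ->
  is_derive x 1 (fun y => cos (f y)) (- sin (f x) * a).
Proof. by apply: dcomp; exact: is_derive_cos. Qed.

Lemma dexpR f x a : is_derive x 1 f a ->
  is_derive x 1 (fun y => expR (f y)) (expR (f x) * a).
Proof. by apply: dcomp; exact: is_derive_expR. Qed.

Lemma dsqrt f x a : 0 < f x -> is_derive x 1 f a ->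
  is_derive x 1 (fun y => Num.sqrt (f y)) ((2 * Num.sqrt (f x))^-1 * a).
Proof. by move=> f0; apply: dcomp; exact: is_derive1_sqrt. Qed.

Lemma derive_continuous f x a : is_derive x 1 f a -> {for x, continuous f}.
Proof.
move=> df; apply: differentiable_continuous.
by apply/derivable1_diffP; exact: (@ex_derive _ _ _ _ _ _ _ df).
Qed.

End PointwiseDerivatives.

Ltac der_step :=
  lazymatch goal with
  | |- is_derive _ _ (fun _ => ?c) _ => notypeclasses refine (dcst _ _)
  | |- is_derive _ _ (fun y => y) _ => notypeclasses refine (did _)
  | |- is_derive _ _ (fun y => @?f y + @?g y) _ => notypeclasses refine (@dadd _ f g _ _ _ _ _)
  | |- is_derive _ _ (fun y => - @?f y) _ => notypeclasses refine (@dopp _ f _ _ _)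
  | |- is_derive _ _ (fun y => @?f y * @?g y) _ => notypeclasses refine (@dmul _ f g _ _ _ _ _)
  | |- is_derive _ _ (fun y => @?f y ^+ _.+1) _ => notypeclasses refine (@dexpn _ f _ _ _ _)
  | |- is_derive _ _ (fun y => (@?f y)^-1) _ => notypeclasses refine (@dinv _ f _ _ _ _)
  | |- is_derive _ _ (fun y => sin (@?f y)) _ => notypeclasses refine (@dsin _ f _ _ _)
  | |- is_derive _ _ (fun y => cos (@?f y)) _ => notypeclasses refine (@dcos _ f _ _ _)
  | |- is_derive _ _ (fun y => expR (@?f y)) _ => notypeclasses refine (@dexpR _ f _ _ _)
  | |- is_derive _ _ (fun y => Num.sqrt (@?f y)) _ => notypeclasses refine (@dsqrt _ f _ _ _ _)
  end.
(* Typeclass resolution is kept away: it would pick the library's combinators, whose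
   derivatives are displayed with scalings instead of products. *)
Ltac der :=
  notypeclasses refine (@deq _ _ _ _ _ _ _);
  [repeat (first [der_step | solve [eauto 3 with nocore]]) | cbv beta].

(** * Monotonicity, barriers and primitives on the line *)

Section Calculus.
Context {R : realType}.
Implicit Types (f g h : R -> R) (x a b : R).

Lemma continuous_within f a b : {in `[a, b], forall x, {for x, continuous f}} ->
  {within `[a, b], continuous f}.
Proof.
move=> cf; apply: continuous_in_subspaceT => x; rewrite inE => xab.
exact: cf.
Qed.

Lemma mvt f g a b : a < b -> (forall x, a <= x <= b -> is_derive x 1 f (g x)) ->
  exists2 c, a < c < b & f b - f a = g c * (b - a).
Proof.
move=> ab df; have [||c] := @MVT _ f g _ _ ab.
- by move=> x; rewrite in_itv/= => /andP[ax xb]; apply: df; rewrite !ltW.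
- by apply: continuous_within => x xab; apply: (derive_continuous (df x _)).
- by rewrite in_itv/=; exists c.
Qed.

Lemma derive_ge0_le f g a b : a <= b ->
  (forall x, a <= x <= b -> is_derive x 1 f (g x)) ->
  (forall x, a < x < b -> 0 <= g x) -> f a <= f b.
Proof.
rewrite le_eqVlt => /predU1P[->//|ab] df g0.
have [c cab e] := mvt ab df.
by rewrite -subr_ge0 e mulr_ge0 ?g0 // subr_ge0 ltW.
Qed.

Lemma derive0_eq f a b : a <= b ->
  (forall x, a <= x <= b -> is_derive x 1 f 0) -> f a = f b.
Proof.
move=> ab df; apply/eqP; rewrite eq_le (derive_ge0_le ab df) //=.
rewrite -lerN2; apply: (@derive_ge0_le (fun y => - f y) (fun=> - 0)) => //.
by move=> x xab; apply: dopp; exact: df.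
Qed.

Lemma derive_le f g a b (df dg : R -> R) : a <= b ->
  (forall x, a <= x <= b -> is_derive x 1 f (df x)) ->
  (forall x, a <= x <= b -> is_derive x 1 g (dg x)) ->
  (forall x, a < x < b -> df x <= dg x) -> f b - f a <= g b - g a.
Proof.
move=> ab Df Dg fg.
have := @derive_ge0_le (fun y => g y - f y) (fun y => dg y - df y) a b ab.
have D x : a <= x <= b -> is_derive x 1 (fun y => g y - f y) (dg x - df x).
  by move=> xab; apply: dadd; [exact: Dg|apply: dopp; exact: Df].
by move=> /(_ D) H; have : g a - f a <= g b - f b; [apply: H => x /fg; lra|lra].
Qed.

Lemma derive_near f x a e : is_derive x 1 f a -> 0 < e ->
  exists2 d, 0 < d & forall y, `|y - x| < d -> `|f y - f x - a * (y - x)| <= e * `|y - x|.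
Proof.
move=> /is_derive1_caratheodory[g [fg cg gxa]] e0.
move/cvgrPdist_le: cg => /(_ e e0) /nbhs_ballP[d /= d0 H].
exists d => // y yxd; rewrite fg -mulrBl normrM ler_wpM2r // distrC -gxa.
by apply: H; rewrite /ball /= distrC.
Qed.

(** The witness is the supremum of the points where [c <= f]. It isolates a final stretch below [c],
    the starting point of the barrier and comparison arguments. *)
Lemma last_ge f a b c : a <= b -> (forall x, a <= x <= b -> {for x, continuous f}) ->
  c <= f a -> f b < c ->
  exists s, [/\ a <= s < b, f s = c & forall x, s < x <= b -> f x < c].
Proof.
move=> ab cf fa fb; pose A := [set x | a <= x <= b /\ c <= f x].
have Aa : A a by split; rewrite ?lexx.
have ubA : has_ubound A by exists b => x [/andP[]].
have hsA : has_sup A by split => //; exists a.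
have as_ : a <= sup A by exact: ub_le_sup.
have sb : sup A <= b by apply: ge_sup; [exists a|move=> x [/andP[]]].
have cs : {for sup A, continuous f} by apply: cf; rewrite as_ sb.
have fs : c <= f (sup A).
  rewrite leNgt; apply/negP => fsc.
  have [d /= d0 H] := (nbhs_ballP _ _).1 (cvgr_lt _ cs _ fsc).
  have [x [xab cx] sx] := sup_adherent d0 hsA.
  have xs : x <= sup A by apply: ub_le_sup => //; split.
  suff : f x < c by rewrite ltNge cx.
  by apply: H; rewrite /ball /= ger0_norm ?subr_ge0 // ltrBlDr -ltrBlDl.
have sltb : sup A < b.
  by rewrite lt_neqAle sb andbT; apply/eqP => e; move: fs; rewrite e leNgt fb.
have right x : sup A < x <= b -> f x < c.
  move=> /andP[sx xb]; rewrite ltNge; apply/negP => cx.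
  have : x <= sup A.
    by apply: ub_le_sup => //; split => //; rewrite (le_trans as_ (ltW sx)).
  by rewrite leNgt sx.
exists (sup A); split => //; first by rewrite as_.
apply/eqP; rewrite eq_le fs andbT leNgt; apply/negP => cfs.
have [d /= d0 H] := (nbhs_ballP _ _).1 (cvgr_gt _ cs _ cfs).
pose y := sup A + Num.min (d / 2) (b - sup A).
have m0 : 0 < Num.min (d / 2) (b - sup A) by rewrite lt_min divr_gt0 // subr_gt0.
have /right : sup A < y <= b.
  by rewrite /y ltrDl m0 /= -lerBrDl ge_min lexx orbT.
apply/negP; rewrite -leNgt ltW //; apply: H.
rewrite /ball /= /y opprD addNKr normrN gtr0_norm //.
by rewrite gt_min ltr_pdivrMr // ltr_pMr // ltr1n.
Qed.

(** At the last point where [f = c] before a value below [c], the positive slope would push [f]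
    above [c] just to the right. *)
Lemma barrier f g a c : (forall x, a <= x -> is_derive x 1 f (g x)) ->
  (forall x, a <= x -> f x = c -> 0 < g x) -> c <= f a ->
  forall x, a <= x -> c <= f x.
Proof.
move=> df gc fa x ax; rewrite leNgt; apply/negP => fxc.
have [|s [/andP[as_ sx] fs sfc]] := @last_ge f a x c ax _ fa fxc.
  by move=> y /andP[ay _]; exact: derive_continuous (df y ay).
have gs := gc s as_ fs.
have [d d0 H] := derive_near (df s as_) (divr_gt0 gs (ltr0n _ 2)).
pose y := s + Num.min (d / 2) (x - s).
have m0 : 0 < Num.min (d / 2) (x - s) by rewrite lt_min divr_gt0 // subr_gt0.
have sy : s < y by rewrite /y ltrDl.
have := H y; rewrite /y addrC addKr gtr0_norm // gt_min ltr_pdivrMr //.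
rewrite ltr_pMr // ltr1n /= => /(_ isT); rewrite addrC -/y.
have := sfc y; rewrite sy /y -lerBrDl ge_min lexx orbT -/y => /(_ isT) fy.
rewrite fs ler_norml => /andP[+ _]; move: m0 gs fy.
set m := Num.min _ _; nra.
Qed.

(** The fundamental theorem for [I a] holds only to the right of the base point [a], so the base
    point moves with [y]. Subtracting [I a 0] makes [P a] independent of [a < 0]; near [x] the
    moving base is exchanged for the fixed one [- |x| - 2]. *)
Lemma continuous_primitive f : continuous f ->
  exists2 F, F 0 = 0 & forall x, is_derive x 1 F (f x).
Proof.
move=> cf; pose mu := @lebesgue_measure R.
pose I a y := \int[mu]_(t in `[a, y]) f t; pose P a y := I a y - I a 0.
have dP a x : a < x -> is_derive x 1 (P a) (f x).
  move=> ax; have xx1 : x < x + 1 by rewrite ltrDl.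
  have intf : mu.-integrable `[a, x + 1] (EFin \o f).
    apply: continuous_compact_integrable; first exact: segment_compact.
    exact: continuous_subspaceT.
  have [D E] := continuous_FTC1_closed xx1 intf ax (cf x).
  have dI : is_derive x 1 (I a) (f x).
    by apply: (deq (derivableP D)); rewrite -derive1E.
  by rewrite /P; der; ring.
have PE a b x : a < x -> a < 0 -> b < x -> b < 0 -> P a x = P b x.
  move=> ax a0 bx b0; apply/eqP; rewrite -subr_eq0; apply/eqP.
  have D y : a < y -> b < y -> is_derive y 1 (fun y => P a y - P b y) 0.
    move=> ay b_y; have := dP a y ay; have := dP b y b_y => Da Db.
    by der; ring.
  suff : P a x - P b x = P a 0 - P b 0 by rewrite /P !subrr.
  have [x0|/ltW x0] := leP x 0.
    apply: (@derive0_eq (fun y => P a y - P b y)) => // y /andP[l r].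
    by apply: D; exact: lt_le_trans l.
  symmetry; apply: (@derive0_eq (fun y => P a y - P b y)) => // y /andP[l r].
  by apply: D; exact: lt_le_trans l.
exists (fun y => P (- `|y| - 1) y); first by rewrite /P subrr.
have ly (y : R) : - `|y| - 1 < y by have := lerNnormlW (lexx `|y|); lra.
have l0 (y : R) : - `|y| - 1 < 0 by have := normr_ge0 y; lra.
move=> x; apply: (@near_eq_is_derive _ _ _ (P (- `|x| - 2))) => //.
  near=> y; apply: PE; [|by have := l0 x; lra|exact: ly|exact: l0].
  have : `|y - x| < 1 by rewrite distrC; near: y; exact: nbhsx_ballx.
  by have := ly x; rewrite ltr_norml => ? /andP[]; lra.
by apply: dP; have := ly x; lra.
Unshelve. all: by end_near. Qed.

End Calculus.

(** * Gronwall and comparison inequalities *)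

Section Gronwall.
Context {R : realType}.
Implicit Types (f g : R -> R) (x a b : R).

(** The quantity [D ^+ 2 + d ^+ 2] avoids the kink of [|D|] and absorbs the inhomogeneity, as
    [2 |D| d <= D ^+ 2 + d ^+ 2]. The forward bound serves the dependence on initial angles, the
    backward one transports estimates from the trap to 0. *)
Lemma gronwall (D g : R -> R) (L d a b : R) : a <= b -> 0 <= L -> 0 <= d ->
  (forall x, a <= x <= b -> is_derive x 1 D (g x)) ->
  (forall x, a <= x <= b -> `|g x| <= L * `|D x| + d) ->
  D b ^+ 2 + d ^+ 2 <= (D a ^+ 2 + d ^+ 2) * expR ((2 * L + 1) * (b - a)) /\
  D a ^+ 2 + d ^+ 2 <= (D b ^+ 2 + d ^+ 2) * expR ((2 * L + 1) * (b - a)).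
Proof.
move=> ab L0 d0 dD gD; set c := 2 * L + 1.
have key x : a <= x <= b -> `|2 * D x * g x| <= c * (D x ^+ 2 + d ^+ 2).
  move=> /gD; rewrite !normrM -[D x ^+ 2]real_normK ?num_real //.
  rewrite (ger0_norm (ler0n _ _)) /c; have := normr_ge0 (g x).
  have := normr_ge0 (D x); move: `|D x| `|g x| => u v u0 v0 uv.
  have : u * v <= u * (L * u + d) by rewrite ler_wpM2l.
  have := sqr_ge0 (u - d); have := mulr_ge0 L0 (sqr_ge0 d).
  rewrite !expr2; nra.
split.
  have H : forall x, a <= x <= b -> is_derive x 1
      (fun y => - ((D y ^+ 2 + d ^+ 2) * expR (c * (a - y))))
      ((c * (D x ^+ 2 + d ^+ 2) - 2 * D x * g x) * expR (c * (a - x))).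
    by move=> x /dD Dx; der; ring.
  have := derive_ge0_le ab H; rewrite subrr mulr0 expR0 mulr1 lerN2 => H1.
  rewrite -(@ler_pM2r _ (expR (c * (a - b)))) ?expR_gt0 //.
  rewrite -mulrA -expRD (_ : c * (b - a) + c * (a - b) = 0) ?expR0 ?mulr1; last by ring.
  apply: H1 => x /andP[ax xb]; apply: mulr_ge0; last exact: expR_ge0.
  have xab : a <= x <= b by rewrite !ltW.
  have := key x xab; rewrite ler_norml => /andP[]; lra.
have H : forall x, a <= x <= b -> is_derive x 1
    (fun y => ((D y ^+ 2 + d ^+ 2) * expR (c * (y - a))))
    ((c * (D x ^+ 2 + d ^+ 2) + 2 * D x * g x) * expR (c * (x - a))).
  by move=> x /dD Dx; der; ring.
have := derive_ge0_le ab H; rewrite subrr mulr0 expR0 mulr1; apply.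
move=> x /andP[ax xb]; apply: mulr_ge0; last exact: expR_ge0.
have xab : a <= x <= b by rewrite !ltW.
have := key x xab; rewrite ler_norml => /andP[]; lra.
Qed.

(** On the last stretch []s, b]] where [D > 0], the product of [D] and [exp (- L y)] is
    nonincreasing, and it vanishes at [s]. *)
Lemma comparison_forward (D g : R -> R) (L a b : R) : a <= b ->
  (forall x, a <= x <= b -> is_derive x 1 D (g x)) ->
  (forall x, a <= x <= b -> 0 < D x -> g x <= L * D x) ->
  D a <= 0 -> D b <= 0.
Proof.
move=> ab dD gD Da; rewrite leNgt; apply/negP => Db.
have [|||s [/andP[as_ sb] Ds pos]] := @last_ge R (fun y => - D y) a b 0 ab.
- by move=> x /dD Dx; apply: (derive_continuous (dopp Dx)).
- by rewrite oppr_ge0.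
- by rewrite oppr_lt0.
have H : forall x, s <= x <= b -> is_derive x 1
    (fun y => - (D y * expR (- (L * y))))
    ((L * D x - g x) * expR (- (L * x))).
  move=> x /andP[sx xb]; have Dx := dD x; rewrite xb (le_trans as_) // in Dx.
  by have := Dx isT => {}Dx; der; ring.
have := derive_ge0_le (ltW sb) H; rewrite -[D s]opprK Ds oppr0 mul0r oppr0.
move=> H1; suff : 0 <= - (D b * expR (- (L * b))).
  by rewrite oppr_ge0 pmulr_lle0 ?expR_gt0 // leNgt Db.
apply: H1 => x /andP[sx xb].
rewrite mulr_ge0 ?expR_ge0 // subr_ge0 gD //.
  by rewrite !ltW // ?(le_lt_trans as_).
by rewrite -oppr_lt0 pos // sx ltW.
Qed.

Lemma comparison_backward (D g : R -> R) (L a b : R) : a <= b ->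
  (forall x, a <= x <= b -> is_derive x 1 D (g x)) ->
  (forall x, a <= x <= b -> 0 < D x -> - (L * D x) <= g x) ->
  D b <= 0 -> D a <= 0.
Proof.
move=> ab dD gD Db.
rewrite -[a]opprK; apply: (@comparison_forward (fun y => D (- y))
  (fun y => - g (- y)) L (- b) (- a)); rewrite ?lerN2 ?opprK //.
  move=> x xab; have Dx : is_derive (- x) 1 D (g (- x)) by apply: dD; lra.
  have [_ _] := (did x, dcomp Dx (dopp (did x))).
  by apply: deq; rewrite mulrN1.
by move=> x xab Dx; rewrite lerNl; apply: gD => //; lra.
Qed.

End Gronwall.

(** * Global solutions of scalar equations *)

Section Picard.
Context {R : realType}.
Implicit Types (f g : R -> R) (x a b : R).

Definition prim f : R -> R :=
  xget (fun=> 0) [set F | F 0 = 0 /\ forall x, is_derive x 1 F (f x)].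

Lemma prim_derive f : continuous f -> forall x, is_derive x 1 (prim f) (f x).
Proof.
move=> cf; have [F F0 dF] := continuous_primitive cf.
by rewrite /prim; case: xgetP => [G _ []//|/(_ F)]; case.
Qed.

Lemma contD f g : continuous f -> continuous g -> continuous (fun x => f x + g x).
Proof. by move=> cf cg x; apply: cvgD; [exact: cf|exact: cg]. Qed.

Lemma contM f g : continuous f -> continuous g -> continuous (fun x => f x * g x).
Proof. by move=> cf cg x; apply: cvgM; [exact: cf|exact: cg]. Qed.

Lemma cont_norm f : continuous f -> continuous (fun x => `|f x|).
Proof. by move=> cf x; apply: cvg_norm; exact: cf. Qed.

Lemma cont_cst (c : R) : continuous (fun _ : R => c).
Proof. by move=> x; exact: cvg_cst. Qed.

Lemma derive_cont f g : (forall x, is_derive x 1 f (g x)) -> continuous f.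
Proof. by move=> df x; exact: derive_continuous (df x). Qed.

(* Convergence is measured against the weight [E = exp(2 l) + exp(-2 l)] with [l' = K] a
   Lipschitz constant: each iteration then halves the error on the whole line. *)
Theorem picard (f : R -> R -> R) (L : R -> R) (t0 a0 : R) :
  (forall th : R -> R, continuous th -> continuous (fun x => f x (th x))) ->
  continuous L -> (forall x a b, `|f x a - f x b| <= L x * `|a - b|) ->
  exists2 th : R -> R, th t0 = a0 & forall x, is_derive x 1 th (f x (th x)).
Proof.
move=> fc cL fL.
have L0 x : 0 <= L x.
  by have := le_trans (normr_ge0 _) (fL x 1 0); rewrite subr0 normr1 mulr1.
(* Adding [|f x a0|] to the Lipschitz constant makes the first iterate obey the same kind of bound
   as the later ones. *)
pose K x := L x + `|f x a0|.
have cK : continuous K.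
  by apply: contD => //; apply: cont_norm; apply: fc; exact: cont_cst.
have K0 x : 0 <= K x by rewrite addr_ge0.
pose l x := prim K x - prim K t0.
have dl x : is_derive x 1 l (K x).
  by have dK := prim_derive cK x; rewrite /l; der; ring.
pose E x := expR (2 * l x) + expR (- (2 * l x)).
pose S x := (expR (2 * l x) - expR (- (2 * l x))) / 2.
have dS x : is_derive x 1 S (K x * E x).
  by have dx := dl x; rewrite /S /E; der; field.
have S0 : S t0 = 0 by rewrite /S /l subrr mulr0 oppr0 subrr mul0r.
have E0 x : 0 < E x by rewrite addr_gt0 ?expR_gt0.
have E1 x : 1 <= E x.
  rewrite /E; have [h|h] := leP 0 (2 * l x).
    by have := expR_ge1Dx (2 * l x); have := expR_ge0 (- (2 * l x)); lra.
  by have := expR_ge1Dx (- (2 * l x)); have := expR_ge0 (2 * l x); lra.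
have cE : continuous E.
  apply: derive_cont => x; by have dx := dl x; rewrite /E; der; reflexivity.
have bound (D g : R -> R) (c : R) : 0 <= c -> D t0 = 0 ->
    (forall x, is_derive x 1 D (g x)) -> (forall x, `|g x| <= c * (K x * E x)) ->
    forall x, `|D x| <= c * E x / 2.
  move=> c0 Dt0 dD gD x.
  have dcS (y : R) : is_derive y 1 (fun y => c * S y) (c * (K y * E y)).
    by have dy := dS y; der; ring.
  have dN (y : R) : is_derive y 1 (fun y => - D y) (- g y) by have dy := dD y; der.
  have SE : `|S x| <= E x / 2.
    rewrite /S /E ler_norml.
    by have := expR_ge0 (2 * l x); have := expR_ge0 (- (2 * l x)); lra.
  suff : `|D x| <= c * `|S x|.
    by move=> /le_trans; apply; rewrite -mulrA ler_wpM2l.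
  rewrite -[in leRHS](ger0_norm c0) -normrM.
  have up y : g y <= c * (K y * E y) by have := gD y; rewrite ler_norml => /andP[].
  have dn y : - g y <= c * (K y * E y).
    by have := gD y; rewrite ler_norml => /andP[]; lra.
  have [tx|/ltW xt] := leP t0 x.
    have := @derive_le _ _ _ _ _ _ _ tx (fun y _ => dD y) (fun y _ => dcS y) (fun y _ => up y).
    have := @derive_le _ _ _ _ _ _ _ tx (fun y _ => dN y) (fun y _ => dcS y) (fun y _ => dn y).
    rewrite S0 Dt0 => h1 h2; rewrite ler_norml; have := ler_norm (c * S x); lra.
  have := @derive_le _ _ _ _ _ _ _ xt (fun y _ => dD y) (fun y _ => dcS y) (fun y _ => up y).
  have := @derive_le _ _ _ _ _ _ _ xt (fun y _ => dN y) (fun y _ => dcS y) (fun y _ => dn y).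
  rewrite S0 Dt0 => h1 h2; rewrite ler_norml -normrN.
  have := ler_norm (- (c * S x)); lra.
pose step (th : R -> R) x := a0 + (prim (fun y => f y (th y)) x -
                                  prim (fun y => f y (th y)) t0).
have dstep th : continuous th -> forall x, is_derive x 1 (step th) (f x (th x)).
  by move=> /fc/prim_derive dp x; have dx := dp x; rewrite /step; der; ring.
have step0 th : step th t0 = a0 by rewrite /step subrr addr0.
pose T n := iter n step (fun=> a0).
have cT n : continuous (T n).
  elim: n => [|n IH]; first exact: cont_cst.
  by apply: derive_cont; exact: dstep.
have dT n x : is_derive x 1 (T n.+1) (f x (T n x)) by exact: dstep.
have half n : (2 : R)^-1 ^+ n.+1 = 2^-1 ^+ n / 2 by rewrite exprS mulrC.
have p0 n : 0 < (2 : R)^-1 ^+ n by rewrite exprn_gt0 // invr_gt0.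
have TE n x : `|T n.+1 x - T n x| <= 2^-1 ^+ n * E x.
  elim: n x => [x|n IH x].
    rewrite expr0 mul1r.
    have := @bound (fun y => T 1 y - T 0 y) (fun y => f y a0) 1 ler01.
    rewrite /T /= step0 subrr => /(_ erefl) H.
    apply: (le_trans (H _ _ x)); last by have := E0 x; lra.
      move=> y; have dy := dT 0 y; rewrite /T /= in dy; der; ring.
    move=> y; rewrite mul1r; apply: (@le_trans _ _ (K y)); first by rewrite lerDr.
    by rewrite ler_peMr.
  rewrite half mulrAC.
  apply: (@bound (fun y => T n.+2 y - T n.+1 y) (fun y => f y (T n.+1 y) - f y (T n y))).
  - exact: ltW.
  - by rewrite /T /= !step0 subrr.
  move=> y; apply: (le_trans (fL _ _ _)); rewrite mulrCA.
  by apply: ler_pM => //; rewrite lerDl.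
(* The margin is the geometric tail of [TE], so [lo] increases and [hi] decreases with [n]; the
   limit can then be taken pointwise as a supremum, with an explicit rate. *)
pose lo n x := T n x - 2 * 2^-1 ^+ n * E x.
pose hi n x := T n x + 2 * 2^-1 ^+ n * E x.
have lohi m n x : lo n x <= hi m x.
  have lo_mono k : lo n x <= lo (n + k)%N x.
    elim: k => [|k IH]; first by rewrite addn0.
    apply: (le_trans IH); rewrite addnS /lo half; have := TE (n + k)%N x.
    by rewrite ler_norml => /andP[]; lra.
  have hi_mono k : hi (m + k)%N x <= hi m x.
    elim: k => [|k IH]; first by rewrite addn0.
    apply: le_trans IH; rewrite addnS /hi half; have := TE (m + k)%N x.
    by rewrite ler_norml => /andP[]; lra.
  apply: (le_trans (lo_mono m)); apply: le_trans (hi_mono n).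
  rewrite addnC /lo /hi; have := mulr_ge0 (ltW (p0 (m + n)%N)) (ltW (E0 x)); lra.
pose th x := sup (range (lo ^~ x)).
have thT n x : `|th x - T n x| <= 2 * 2^-1 ^+ n * E x.
  have lo_le : lo n x <= th x.
    by apply: ub_le_sup; [exists (hi 0%N x) => _ [k _ <-]|exists n].
  have hi_ge : th x <= hi n x.
    by apply: ge_sup; [exists (lo 0%N x), 0%N|move=> _ [k _ <-]].
  by move: lo_le hi_ge; rewrite /lo /hi ler_norml; lra.
have small (e : R) (c : R) : 0 < e -> 0 < c -> exists n, c * 2^-1 ^+ n < e.
  move=> e0 c0.
  have : (2^-1 : R) ^+ n @[n --> \oo] --> (0 : R).
    by apply: cvg_expr; rewrite gtr0_norm ?invr_gt0 // invf_lt1 // ltr1n.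
  move/cvgr0Pnorm_lt => /(_ _ (divr_gt0 e0 c0)) [N _ HN].
  exists N; have := HN N (leqnn N); rewrite /= gtr0_norm //.
  by rewrite ltr_pdivlMr // mulrC.
have cth : continuous th.
  move=> x; apply/cvgrPdist_lt => e e0.
  have [|n hn] := @small e (2 * (4 * E x + 2)) e0.
    by have := E0 x; lra.
  have e4 : 0 < e / 4 by lra.
  near=> y.
  have Ey : E y <= E x + 1.
    by apply: ltW; near: y; apply: (cvgr_lt _ (cE x)); rewrite ltrDl.
  have Ty : `|T n x - T n y| < e / 4.
    by near: y; move/cvgrPdist_lt: (cT n x); exact.
  have hx := thT n x; have hy := thT n y.
  have pE : 2^-1 ^+ n * E y <= 2^-1 ^+ n * (E x + 1) by rewrite ler_wpM2l // ltW.
  move: hx hy Ty; rewrite !ler_norml !ltr_norml.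
  have := p0 n; have := mulr_ge0 (ltW (p0 n)) (ltW (E0 x)).
  set p := _ ^+ n in hn pE *; move: (E x) (E y) => ex ey in hn pE *; lra.
exists th => [|x].
  apply/eqP; rewrite -subr_eq0 -normr_le0 leNgt; apply/negP => h.
  have [|n hn] := @small _ (2 * E t0) h; first by rewrite mulr_gt0.
  have := thT n t0; rewrite (_ : T n t0 = a0); last by case: n {hn} => //= n; rewrite step0.
  by rewrite leNgt mulrAC hn.
suff e : step th = th by have := dstep th cth x; rewrite e.
apply/funext => {}x; apply/eqP; rewrite -subr_eq0 -normr_le0 leNgt; apply/negP => h.
have [|n hn] := @small _ (3 * E x) h; first by rewrite mulr_gt0.
have := @bound (fun y => step th y - T n.+1 y) (fun y => f y (th y) - f y (T n y))
  (2 * 2^-1 ^+ n).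
have pn := p0 n; rewrite mulr_ge0 ?ltW // {2}/T /= !step0 subrr => /(_ isT erefl).
have H (y : R) : is_derive y 1 (fun y => step th y - step (iter n step (fun=> a0)) y)
    (f y (th y) - f y (T n y)).
  by have d1 := dstep th cth y; have d2 := dT n y; rewrite /T /= in d2; der.
move=> /(_ H) /(_ _ x) H2.
have {H2} : `|step th x - T n.+1 x| <= 2 * 2^-1 ^+ n * E x / 2.
  apply: H2 => y; apply: (le_trans (fL _ _ _)).
  by rewrite mulrCA; apply: ler_pM => //; rewrite lerDl.
have := thT n.+1 x; rewrite half; move: hn.
have -> : step th x - th x = (step th x - T n.+1 x) - (th x - T n.+1 x) by ring.
have := ler_normB (step th x - T n.+1 x) (th x - T n.+1 x).
have := mulr_gt0 pn (E0 x); set p := _ ^+ n; lra.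
Unshelve. all: by end_near. Qed.

End Picard.

Section Trigonometry.
Context {R : realType}.
Implicit Types (x a b : R).

Lemma abs_sin_le1 x : `|sin x| <= 1.
Proof. by rewrite ler_norml sin_le1 sin_geN1. Qed.

Lemma abs_cos_le1 x : `|cos x| <= 1.
Proof. by rewrite ler_norml cos_le1 cos_geN1. Qed.

Lemma cos_pi4_sqr : cos (pi / 4) ^+ 2 = 2^-1 :> R.
Proof.
have := @cos_pihalf R; rewrite (_ : pi / 2 = pi / 4 + pi / 4); last by field.
rewrite cosD; have := cos2Dsin2 (pi / 4 : R); rewrite !expr2; lra.
Qed.

Lemma sin_pi4 : sin (pi / 4) = cos (pi / 4) :> R.
Proof.
by rewrite -cosBpihalf -cosN; congr cos; field.
Qed.

Lemma cos_pi4_gt0 : 0 < cos (pi / 4) :> R.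
Proof. by apply: cos_gt0_pihalf; have := pi_gt0 R; lra. Qed.

Lemma cos_pi4_gt : 2 / 3 < cos (pi / 4) :> R.
Proof. by have := cos_pi4_sqr; have := cos_pi4_gt0; rewrite expr2; nra. Qed.

Lemma le_2sin x : 0 <= x <= pi / 4 -> x <= 2 * sin x.
Proof.
move=> /andP[x0 x4]; have p0 := pi_gt0 R.
have H (y : R) : 0 <= y <= x -> is_derive y 1 (fun y => 2 * sin y - y) (2 * cos y - 1).
  by move=> _; der; ring.
have := derive_ge0_le x0 H; rewrite sin0 mulr0 subrr subr_ge0; apply.
move=> y /andP[y0 yx].
have : cos (pi / 4) <= cos y.
  apply/ltW; rewrite ltr_cos ?in_itv /=; lra.
by have := cos_pi4_gt; lra.
Qed.

Lemma sin_natpi (n : nat) : sin (n%:R * pi) = 0 :> R.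
Proof.
elim: n => [|n IH]; first by rewrite mul0r sin0.
by rewrite -natr1 mulrDl mul1r sinDpi IH oppr0.
Qed.

Lemma sin_intpi (k : int) : sin (k%:~R * pi) = 0 :> R.
Proof.
case: k => n; first by rewrite -pmulrn sin_natpi.
by rewrite NegzE mulrNz mulNr sinN -pmulrn sin_natpi oppr0.
Qed.

Lemma sin_eq0P x : sin x = 0 -> exists k : int, x = k%:~R * pi.
Proof.
move=> sx; pose k := Num.floor (x / pi); exists k.
have p0 := pi_gt0 R.
have /andP[k1 k2] := mem_rg1_floor (x / pi); rewrite -/k in k1 k2.
have y0 : 0 <= x - k%:~R * pi by rewrite subr_ge0 -ler_pdivlMr.
have y1 : x - k%:~R * pi < pi.
  by move: k2; rewrite ltr_pdivrMr // mulrDl mul1r; lra.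
apply/eqP; rewrite -subr_eq0; apply/eqP.
move: y0; rewrite le_eqVlt => /predU1P[<-//|y0].
have := @sin_gt0_pi R (x - k%:~R * pi); rewrite y0 y1 => /(_ isT).
by rewrite sinB sx sin_intpi mul0r mulr0 subrr ltxx.
Qed.

End Trigonometry.

Section LocalDerivative.
Context {R : realType}.

Lemma derive_unique (f : R -> R) (x a b : R) :
  is_derive x 1 f a -> is_derive x 1 f b -> a = b.
Proof. by move=> [_ <-] [_ <-]. Qed.

Lemma derive_locally_cst (f : R -> R) (a b x c g : R) :
  (forall y, a < y < b -> f y = c) -> a < x < b -> is_derive x 1 f g -> g = 0.
Proof.
move=> fc xab df; apply: derive_unique df _.
apply: (@near_eq_is_derive _ _ _ (fun=> c)).
near=> y; apply/esym/fc; near: y.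
have xI : x \in `]a, b[ by rewrite in_itv.
by have := near_in_itvoo xI; apply: filterS => y; rewrite in_itv.
Unshelve. all: by end_near. Qed.

End LocalDerivative.

(** * The angle equation: comparison, stability, barriers *)

Section PruferEquation.
Context {R : realType}.
Implicit Types (Q th ph : R -> R) (mu x a b M : R).

(* The Prufer angle of [u'' = (x + q - mu) u], with [Q' = q] and the quasi-derivative
   [u1 = u' - Q u]: [u = r sin th], [u1 = r cos th].  Only [Q] enters, not [q]. *)
Definition prufer Q mu x a : R := (cos a + Q x * sin a) ^+ 2 - (x - mu) * sin a ^+ 2.

Definition prufer_solution Q mu th := forall x, is_derive x 1 th (prufer Q mu x (th x)).

Lemma prufer_lipschitz Q mu x a b :
  `|prufer Q mu x a - prufer Q mu x b| <=
    (2 * (1 + `|Q x|) ^+ 2 + 2 * (`|x| + `|mu|)) * `|a - b|.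
Proof.
set K := (X in _ <= X * _).
pose g y := 2 * (cos y + Q x * sin y) * (- sin y + Q x * cos y)
            - (x - mu) * (2 * sin y * cos y).
have D (y : R) : is_derive y 1 (prufer Q mu x) (g y).
  by rewrite /prufer /g; der; ring.
have gK y : `|g y| <= K.
  have S1 := abs_sin_le1 y; have C1 := abs_cos_le1 y.
  have q0 := normr_ge0 (Q x).
  have le1 (u v : R) : `|u| <= 1 -> `|v| <= 1 -> `|u + Q x * v| <= 1 + `|Q x|.
    move=> hu hv; apply: (le_trans (ler_normD _ _)); apply: lerD => //.
    by rewrite normrM ler_piMr.
  have A : `|(cos y + Q x * sin y) * (- sin y + Q x * cos y)| <= (1 + `|Q x|) ^+ 2.
    by rewrite normrM expr2; apply: ler_pM => //; apply: le1; rewrite ?normrN.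
  have B : `|(x - mu) * (sin y * cos y)| <= `|x| + `|mu|.
    rewrite normrM -[leRHS]mulr1; apply: ler_pM => //; first exact: ler_normB.
    by rewrite normrM -[leRHS]mulr1; apply: ler_pM.
  rewrite /g (_ : _ - _ = 2 * ((cos y + Q x * sin y) * (- sin y + Q x * cos y))
    - 2 * ((x - mu) * (sin y * cos y))); last by ring.
  move: A B; rewrite /K !ler_norml => /andP[? ?] /andP[? ?]; lra.
wlog ab : a b / a < b.
  move=> H; have [/H//|/H|e] := ltgtP a b; first by rewrite distrC (distrC b).
  by rewrite e !subrr normr0 mulr0.
have [c _ e] := mvt ab (fun y _ => D y).
rewrite distrC e normrM (distrC a); apply: ler_wpM2r => //; exact: gK.
Qed.

Lemma prufer_solution_exists Q mu t0 a0 : continuous Q ->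
  exists2 th, th t0 = a0 & prufer_solution Q mu th.
Proof.
move=> cQ.
apply: (@picard _ _ (fun x => 2 * (1 + `|Q x|) ^+ 2 + 2 * (`|x| + `|mu|))).
- move=> th cth; have cs : continuous (fun x => sin (th x)).
    by move=> x; apply: continuous_comp; [exact: cth|exact: continuous_sin].
  have cc : continuous (fun x => cos (th x)).
    by move=> x; apply: continuous_comp; [exact: cth|exact: continuous_cos].
  have cl : continuous (fun x => cos (th x) + Q x * sin (th x)).
    by apply: contD => //; exact: contM.
  under [X in continuous X]eq_fun do rewrite /prufer !expr2 -mulNr.
  apply: contD; first exact: contM.
  apply: contM; last exact: contM.
  by move=> x; apply: cvgN; apply: cvgB; [exact: cvg_id|exact: cvg_cst].
- have cq : continuous (fun x => 1 + `|Q x|).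
    by apply: contD; [exact: cont_cst|exact: cont_norm].
  under [X in continuous X]eq_fun do rewrite !expr2.
  apply: contD; first by apply: contM; [exact: cont_cst|exact: contM].
  apply: contM; first exact: cont_cst.
  apply: contD; last exact: cont_cst.
  by apply: cont_norm => x; exact: cvg_id.
- exact: prufer_lipschitz.
Qed.

Definition prufer_rate M mu a b : R :=
  2 * (1 + M) ^+ 2 + 2 * (`|a| + `|b| + `|mu|).

Lemma prufer_rate_ge0 M mu a b : 0 <= prufer_rate M mu a b.
Proof.
by apply: addr_ge0; apply: mulr_ge0 => //; rewrite ?addr_ge0 ?sqr_ge0.
Qed.

Lemma prufer_lipschitz_on Q M mu a b x u v : (forall x, `|Q x| <= M) -> a <= x <= b ->
  `|prufer Q mu x u - prufer Q mu x v| <= prufer_rate M mu a b * `|u - v|.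
Proof.
move=> QM /andP[ax xb]; apply: (le_trans (prufer_lipschitz _ _ _ _ _)).
apply: ler_wpM2r => //; apply: lerD.
  rewrite ler_pM2l // ler_pXn2r ?nnegrE ?addr_ge0 // ?lerD2l //.
  by apply: le_trans (QM x).
rewrite ler_pM2l // lerD2r.
have [h|h] := leP 0 x; [rewrite (ger0_norm h)|rewrite (ltr0_norm h)].
  by have := ler_norm b; have := normr_ge0 a; lra.
by have := ler_norm (- a); have := normr_ge0 b; rewrite normrN; lra.
Qed.

Lemma prufer_muE Q mu mu' x a :
  prufer Q mu' x a = prufer Q mu x a + (mu' - mu) * sin a ^+ 2.
Proof. rewrite /prufer; ring. Qed.

(** Raising the parameter adds [(mu' - mu) sin^2 >= 0] to the rate, so where [th - ph] is positive
    its derivative is at most a Lipschitz constant times itself. *)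
Lemma prufer_forward Q M mu mu' th ph a b : (forall x, `|Q x| <= M) ->
  mu <= mu' -> prufer_solution Q mu th -> prufer_solution Q mu' ph ->
  a <= b -> th a <= ph a -> th b <= ph b.
Proof.
move=> QM mm sth sph ab h; rewrite -subr_le0; move: h; rewrite -subr_le0.
apply: (@comparison_forward _ (fun y => th y - ph y)
  (fun y => prufer Q mu y (th y) - prufer Q mu' y (ph y)) (prufer_rate M mu a b)) => //.
  by move=> x _; have d1 := sth x; have d2 := sph x; der; ring.
move=> x xab pos; rewrite (prufer_muE _ mu mu').
have := @prufer_lipschitz_on Q M mu a b x (th x) (ph x) QM xab.
rewrite (gtr0_norm pos) ler_norml => /andP[_].
by have := mulr_ge0 (_ : 0 <= mu' - mu) (sqr_ge0 (sin (ph x))); rewrite subr_ge0 => /(_ mm); lra.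
Qed.

Lemma prufer_backward Q M mu mu' th ph a b : (forall x, `|Q x| <= M) ->
  mu <= mu' -> prufer_solution Q mu th -> prufer_solution Q mu' ph ->
  a <= b -> ph b <= th b -> ph a <= th a.
Proof.
move=> QM mm sth sph ab h; rewrite -subr_le0; move: h; rewrite -subr_le0.
apply: (@comparison_backward _ (fun y => ph y - th y)
  (fun y => prufer Q mu' y (ph y) - prufer Q mu y (th y)) (prufer_rate M mu a b)) => //.
  by move=> x _; have d1 := sth x; have d2 := sph x; der; ring.
move=> x xab pos; rewrite (prufer_muE _ mu mu').
have := @prufer_lipschitz_on Q M mu a b x (ph x) (th x) QM xab.
rewrite (gtr0_norm pos) ler_norml => /andP[+ _].
by have := mulr_ge0 (_ : 0 <= mu' - mu) (sqr_ge0 (sin (ph x))); rewrite subr_ge0 => /(_ mm); lra.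
Qed.

Lemma prufer_stable Q Q' M mu mu' th ph a b d : (forall x, `|Q x| <= M) ->
  0 <= d -> prufer_solution Q mu th -> prufer_solution Q' mu' ph ->
  (forall x, a <= x <= b -> `|prufer Q mu x (ph x) - prufer Q' mu' x (ph x)| <= d) ->
  a <= b -> let K := expR ((2 * prufer_rate M mu a b + 1) * (b - a)) in
  (th b - ph b) ^+ 2 + d ^+ 2 <= ((th a - ph a) ^+ 2 + d ^+ 2) * K /\
  (th a - ph a) ^+ 2 + d ^+ 2 <= ((th b - ph b) ^+ 2 + d ^+ 2) * K.
Proof.
move=> QM d0 sth sph hd ab K.
apply: (@gronwall _ (fun y => th y - ph y)
  (fun y => prufer Q mu y (th y) - prufer Q' mu' y (ph y))) => //.
- exact: prufer_rate_ge0.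
- by move=> x _; have d1 := sth x; have d2 := sph x; der; ring.
move=> x xab.
rewrite (_ : _ - _ = (prufer Q mu x (th x) - prufer Q mu x (ph x)) +
  (prufer Q mu x (ph x) - prufer Q' mu' x (ph x))); last by ring.
apply: (le_trans (ler_normD _ _)); apply: lerD; last exact: hd.
exact: prufer_lipschitz_on.
Qed.

(** At a multiple of pi the rate is [cos c ^+ 2 = 1], whatever [Q] and [mu] are, so such angles are
    crossed only upwards. *)
Lemma prufer_barrier0 Q mu th a x c : prufer_solution Q mu th -> sin c = 0 ->
  a <= x -> c <= th a -> c <= th x.
Proof.
move=> sth sc ax ca; apply: (barrier (fun x _ => sth x) _ ca ax) => y _ ->.
rewrite /prufer sc mulr0 addr0 expr0n mulr0 subr0.
by have := cos2Dsin2 c; rewrite sc expr0n addr0 => ->.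
Qed.

(** At [- pi / 4] the rate is [((1 - Q) ^+ 2 - (x - mu)) / 2]. With [|Q| <= 1 / 4] the square is at
    most 25/16, so a distance 2 past [mu] makes the rate negative. *)
Lemma prufer_barrier_pi4 Q mu th a x : prufer_solution Q mu th ->
  (forall y, a <= y -> `|Q y| <= 1 / 4) -> mu + 2 <= a ->
  a <= x -> th a <= - (pi / 4) -> th x <= - (pi / 4).
Proof.
move=> sth Q4 mua ax ta; rewrite -lerN2.
have H (y : R) : is_derive y 1 (fun y => - th y) (- prufer Q mu y (th y)).
  by have dy := sth y; der; ring.
apply: (barrier (fun y _ => H y) _ _ ax); last by rewrite lerN2.
move=> y ay /oppr_inj ->; rewrite /prufer cosN sinN sin_pi4.
rewrite (_ : - _ = ((y - mu) - (1 - Q y) ^+ 2) * cos (pi / 4) ^+ 2); last by ring.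
rewrite cos_pi4_sqr; have := Q4 y ay; rewrite ler_norml expr2 => /andP[? ?]; nra.
Qed.

End PruferEquation.

(** * Solutions that stay in the band, and the phase at 0 *)

Section TrappedSolutions.
Context {R : realType}.
Variables (Q : R -> R) (M X0 : R).
Hypothesis cQ : continuous Q.
Hypothesis QM : forall x, `|Q x| <= M.
Hypothesis X01 : 1 <= X0.
Hypothesis Q4 : forall x, X0 <= x -> `|Q x| <= 1 / 4.
Implicit Types (th ph : R -> R) (mu x a b : R).

Definition trap_start mu : R := Num.max X0 (mu + 2).

Definition trapped mu th := prufer_solution Q mu th /\
  forall x, trap_start mu <= x -> - (pi / 4) <= th x <= 0.

Lemma trap_start_ge mu : X0 <= trap_start mu /\ mu + 2 <= trap_start mu.
Proof. by rewrite !le_max !lexx orbT. Qed.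

Lemma trap_start_mono mu mu' : mu <= mu' -> trap_start mu <= trap_start mu'.
Proof.
move=> mm; rewrite ge_max !le_max lexx /=.
by apply/orP; right; lra.
Qed.

Lemma trapped_barrier mu th a x : prufer_solution Q mu th -> trap_start mu <= a ->
  a <= x -> th a <= - (pi / 4) -> th x <= - (pi / 4).
Proof.
move=> sth; have [h1 h2] := trap_start_ge mu => sa; apply: prufer_barrier_pi4 sth _ _.
  by move=> y ay; apply: Q4; lra.
by lra.
Qed.

Lemma prufer_stable_initial mu a b e : a <= b -> 0 < e -> exists2 d, 0 < d &
  forall th ph, prufer_solution Q mu th -> prufer_solution Q mu ph ->
    `|th a - ph a| < d -> `|th b - ph b| < e.
Proof.
move=> ab e0; pose K := expR ((2 * prufer_rate M mu a b + 1) * (b - a)).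
have K0 : 0 < K by exact: expR_gt0.
have K1 : 0 < K + 1 by lra.
exists (e / (K + 1)); first by rewrite divr_gt0.
move=> th ph sth sph h.
have [|H _] := @prufer_stable _ Q Q M mu mu th ph a b 0 QM (lexx 0) sth sph _ ab.
  by move=> x _; rewrite subrr normr0.
move: H; rewrite -/K expr0n !addr0 => H.
rewrite -(@ltr_pXn2r _ 2) ?nnegrE // ?ltW // real_normK ?num_real //.
apply: (le_lt_trans H).
have : (th a - ph a) ^+ 2 < (e / (K + 1)) ^+ 2.
  by rewrite -real_normK ?num_real // ltr_pXn2r ?nnegrE ?divr_ge0 // ltW.
rewrite expr_div_n ltr_pdivlMr ?exprn_gt0 // !expr2; have := sqr_ge0 (th a - ph a).
by rewrite expr2; nra.
Qed.

(* A shooting argument: among initial angles at [trap_start mu], take the supremum of those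
   which eventually fall below [- pi / 4]. *)
Lemma trapped_exists mu : exists th, trapped mu th.
Proof.
set X := trap_start mu; have p0 := pi_gt0 R.
pose S := [set a | - (pi / 4) <= a <= 0 /\ exists th x,
  [/\ prufer_solution Q mu th, th X = a, X <= x & th x <= - (pi / 4)]].
have S4 : S (- (pi / 4)).
  split; first by lra.
  have [th tX sth] := prufer_solution_exists mu X (- (pi / 4)) cQ.
  by exists th, X; rewrite tX.
have ubS : has_ubound S by exists 0 => a [/andP[]].
have hsS : has_sup S by split => //; exists (- (pi / 4)).
have [th tX sth] := prufer_solution_exists mu X (sup S) cQ.
have s4 : - (pi / 4) <= sup S by exact: ub_le_sup.
have s0 : sup S <= 0 by apply: ge_sup; [exists (- (pi / 4))|move=> a [/andP[]]].
exists th; split => // x Xx; apply/andP; split.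
  rewrite leNgt; apply/negP => thx.
  have sneg : sup S < 0.
    rewrite lt_neqAle s0 andbT; apply/eqP => e.
    have : 0 <= th x by apply: (prufer_barrier0 sth (sin0 R) Xx); rewrite tX e.
    by lra.
  have [|d d0 H] := @prufer_stable_initial mu X x (- (pi / 4) - th x) Xx; first by lra.
  (* By continuous dependence a slightly larger start still falls below [- pi / 4], against the
     choice of the supremum; the minimum keeps [a <= 0]. *)
  pose a := sup S + Num.min (d / 2) (- sup S).
  have m0 : 0 < Num.min (d / 2) (- sup S) by rewrite lt_min divr_gt0 //= oppr_gt0.
  have md : Num.min (d / 2) (- sup S) < d by rewrite gt_min; apply/orP; left; lra.
  have ms : Num.min (d / 2) (- sup S) <= - sup S by rewrite ge_min lexx orbT.
  have [ph pX sph] := prufer_solution_exists mu X a cQ.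
  have Sa : S a.
    split; first by rewrite /a; lra.
    exists ph, x; split => //; have := H ph th sph sth.
    rewrite pX tX /a addrC addKr gtr0_norm // => /(_ md).
    by rewrite ltr_norml => /andP[_]; lra.
  by have := ub_le_sup ubS Sa; rewrite /a; lra.
(* If [th] were positive at [x], so would be some [ph] starting in [S] close to the supremum. But 0
   is not recrossed downwards nor [- pi / 4] upwards, so [ph] cannot visit both sides, in either
   order. *)
rewrite leNgt; apply/negP => thx.
have [d d0 H] := @prufer_stable_initial mu X x (th x) Xx thx.
have [a [a4 [ph [y [sph pX Xy py]]]] sa] := sup_adherent d0 hsS.
have as_ : a <= sup S by apply: ub_le_sup => //; split => //; exists ph, y.
have phx : 0 < ph x.
  have := H th ph sth sph; rewrite tX pX ger0_norm ?subr_ge0 //.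
  by move=> /(_ ltac:(lra)); rewrite ltr_norml => /andP[_]; lra.
have [xy|/ltW yx] := leP x y.
  by have := prufer_barrier0 sph (sin0 R) xy (ltW phx); lra.
by have := trapped_barrier sph Xy yx py; lra.
Qed.

Lemma trapped_neg mu th x : trapped mu th -> trap_start mu <= x -> th x < 0.
Proof.
move=> [sth tth] sx; rewrite lt_neqAle; have /andP[_ ->] := tth x sx.
rewrite andbT; apply/eqP => tx.
have := sth x; rewrite tx /prufer sin0 cos0 mulr0 addr0 expr1n expr0n mulr0 subr0 => D.
have [d d0 H] := @derive_near _ _ _ _ (1 / 2) D ltac:(lra).
have := H (x + d / 2); rewrite addrC addKr gtr0_norm; last by lra.
move=> /(_ ltac:(lra)); rewrite ler_norml => /andP[h _].
by have /andP[_] := tth (x + d / 2) ltac:(lra); lra.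
Qed.

(** The function [- 1 / d - x] is nondecreasing, so [d] would become infinite by [X + 1 / b]. This
    excludes gaps between trapped solutions, which exist on a whole half-line. *)
Lemma no_blowup (d g : R -> R) (X b : R) : 0 < b -> b <= d X ->
  (forall x, X <= x -> is_derive x 1 d (g x)) ->
  (forall x, X <= x -> b <= d x -> d x ^+ 2 <= g x) -> False.
Proof.
move=> b0 dX dd dg.
have db x : X <= x -> b <= d x.
  apply: (barrier dd) => // y Xy dy; apply: lt_le_trans (dg y Xy _); rewrite dy //.
  by rewrite exprn_gt0.
pose Y := X + b^-1.
have XY : X <= Y by rewrite lerDl invr_ge0 ltW.
have H x : X <= x <= Y -> is_derive x 1 (fun y => - (d y)^-1 - y) (g x / d x ^+ 2 - 1).
  move=> /andP[Xx _]; have d0 : d x != 0 by rewrite gt_eqF // (lt_le_trans b0) // db.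
  by have D := dd x Xx; der; ring.
have := derive_ge0_le XY H => /(_ _) h.
have {h} : - (d X)^-1 - X <= - (d Y)^-1 - Y.
  apply: h => x /andP[Xx _]; have dx := db x (ltW Xx).
  have dp : 0 < d x by exact: lt_le_trans dx.
  by rewrite subr_ge0 ler_pdivlMr ?exprn_gt0 // mul1r dg // ltW.
have := db Y XY; have : (d X)^-1 <= b^-1 by rewrite lef_pV2 ?posrE // (lt_le_trans b0).
move=> h1 h2; have : 0 < (d Y)^-1 by rewrite invr_gt0 (lt_le_trans b0).
by rewrite /Y; lra.
Qed.

(** Along a solution this is [u1 / u], which satisfies a Riccati equation. *)
Definition cotangent (a : R) := cos a / sin a.

Lemma cotangent_trapped mu th x : trapped mu th -> trap_start mu <= x ->
  [/\ sin (th x) < 0, cotangent (th x) <= -1 &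
   is_derive x 1 (fun y => cotangent (th y)) (x - mu - (cotangent (th x) + Q x) ^+ 2)].
Proof.
move=> tth sx; have n0 := trapped_neg tth sx; have p0 := pi_gt0 R.
have /andP[p4 _] := tth.2 x sx.
have s0 : sin (th x) < 0.
  rewrite -[th x]opprK sinN oppr_lt0; apply: sin_gt0_pi; lra.
have sc : 0 <= cos (th x) + sin (th x).
  have : 0 <= sin (th x + pi / 4).
    by apply: sin_ge0_pi; lra.
  rewrite sinD sin_pi4 -mulrDl pmulr_lge0 ?cos_pi4_gt0 //; lra.
split => //.
  by rewrite /cotangent ler_ndivrMr //; lra.
have D := tth.1 x; have sn0 : sin (th x) != 0 by rewrite lt_eqF.
rewrite /cotangent; der; rewrite /prufer.
have e : cos (th x) ^+ 2 = 1 - sin (th x) ^+ 2 by rewrite -(cos2Dsin2 (th x)) addrK.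
rewrite (_ : _ + _ = - (cos (th x) ^+ 2 + sin (th x) ^+ 2) / sin (th x) ^+ 2 *
   ((cos (th x) + Q x * sin (th x)) ^+ 2 - (x - mu) * sin (th x) ^+ 2)); last by field.
by rewrite cos2Dsin2; field.
Qed.

(** The cotangents satisfy [(w - z)' = mu' - mu - (w - z) (w + z + 2 Q)]. As [w, z <= -1] and
    [|Q| <= 1 / 4], the last factor is so negative that a gap of the wrong sign, or one larger than
    [mu' - mu], grows at least like its square, which [no_blowup] forbids. The factor 2 comes from
    [le_2sin], on the way back to angles. For [mu = mu'] this is uniqueness past [trap_start]. *)
Lemma trapped_le mu mu' th ph x : mu <= mu' -> trapped mu th -> trapped mu' ph ->
  trap_start mu' <= x -> 0 <= th x - ph x <= 2 * (mu' - mu).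
Proof.
move=> mm tth tph sx.
have sx' : trap_start mu <= x by apply: le_trans sx; exact: trap_start_mono.
have [s1 c1 _] := cotangent_trapped tth sx'.
have [s2 c2 _] := cotangent_trapped tph sx.
have Q4' y : x <= y -> - (1 / 4) <= Q y <= 1 / 4.
  move=> xy; rewrite -ler_norml; apply: Q4.
  by have [h _] := trap_start_ge mu'; lra.
pose w y := cotangent (th y); pose z y := cotangent (ph y).
have wz : w x <= z x.
  rewrite leNgt; apply/negP => h; rewrite -subr_gt0 in h.
  apply: (@no_blowup (fun y => w y - z y) (fun y => (y - mu - (w y + Q y) ^+ 2) -
    (y - mu' - (z y + Q y) ^+ 2)) x (w x - z x)) => //.
    move=> y xy; have [_ _ d1] := cotangent_trapped tth (le_trans sx' xy).
    by have [_ _ d2] := cotangent_trapped tph (le_trans sx xy); rewrite /w /z; der; ring.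
  move=> y xy hy; have [_ w1 _] := cotangent_trapped tth (le_trans sx' xy).
  have [_ z1 _] := cotangent_trapped tph (le_trans sx xy).
  move: (Q4' y xy) h hy w1 z1; rewrite -/(w y) -/(z y) !expr2.
  move: (w y) (z y) (Q y) (w x - z x) => wy zy qy b /andP[? ?] b0 hb ? ?.
  have : 0 <= (wy - zy) * (- (wy + zy + 2 * qy) - (wy - zy)).
    by apply: mulr_ge0; lra.
  by lra.
have zw : z x - w x <= mu' - mu.
  rewrite leNgt; apply/negP => h.
  have h0 : 0 < z x - w x by lra.
  apply: (@no_blowup (fun y => z y - w y) (fun y => (y - mu' - (z y + Q y) ^+ 2) -
    (y - mu - (w y + Q y) ^+ 2)) x (z x - w x)) => //.
    move=> y xy; have [_ _ d1] := cotangent_trapped tth (le_trans sx' xy).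
    by have [_ _ d2] := cotangent_trapped tph (le_trans sx xy); rewrite /w /z; der; ring.
  move=> y xy hy; have [_ w1 _] := cotangent_trapped tth (le_trans sx' xy).
  have [_ z1 _] := cotangent_trapped tph (le_trans sx xy).
  move: (Q4' y xy) h h0 hy w1 z1; rewrite -/(w y) -/(z y) !expr2.
  move: (w y) (z y) (Q y) (z x - w x) => wy zy qy b /andP[? ?] bd b0 hb ? ?.
  have : 0 <= (zy - wy) * (- (wy + zy + 2 * qy) - (zy - wy) - 1).
    by apply: mulr_ge0; lra.
  by lra.
have p0 := pi_gt0 R.
have /andP[t1 t2] := tth.2 x sx'; have /andP[p1 p2] := tph.2 x sx.
have E : sin (th x - ph x) = (z x - w x) * (sin (th x) * sin (ph x)).
  by rewrite sinB /w /z /cotangent; field; rewrite !lt_eqF.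
have ss : 0 < sin (th x) * sin (ph x) by rewrite nmulr_rgt0.
have sD : 0 <= sin (th x - ph x) by rewrite E; apply: mulr_ge0; [rewrite subr_ge0|exact: ltW].
have D0 : 0 <= th x - ph x.
  rewrite leNgt; apply/negP => neg; have := @sin_gt0_pi _ (- (th x - ph x)).
  by rewrite sinN => /(_ ltac:(lra)); lra.
rewrite D0 /=; have := @le_2sin _ (th x - ph x) ltac:(lra).
have : sin (th x - ph x) <= z x - w x.
  have w0 : 0 <= z x - w x by rewrite subr_ge0.
  have s1' : sin (th x) * sin (ph x) <= 1.
    apply: (le_trans (ler_norm _)); rewrite normrM.
    by apply: mulr_ile1; rewrite ?abs_sin_le1.
  by rewrite E ler_piMr.
by lra.
Qed.

(** The default value of [xget] is never taken, by [trapped_exists]. *)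
Definition decaying_angle mu : R -> R := xget (fun=> 0) (trapped mu).

Lemma decaying_angleP mu : trapped mu (decaying_angle mu).
Proof.
by have [th tth] := trapped_exists mu; rewrite /decaying_angle; case: xgetP => [//|/(_ th)].
Qed.

(** The sign makes it increase with [mu]: the angle is pinned in the trap, so a faster rotation must
    have started lower. *)
Definition eigen_phase mu : R := - decaying_angle mu 0.

Lemma trap_start_gt0 mu : 0 < trap_start mu.
Proof. by have [h _] := trap_start_ge mu; exact: lt_le_trans (lt_le_trans ltr01 X01) h. Qed.

(** An angle of at least pi at 0 would be held up by the barrier at pi and miss the band. This bound
    later rules out negative levels. *)
Lemma eigen_phase_gtNpi mu : - pi < eigen_phase mu.
Proof.
rewrite ltrN2 ltNge; apply/negP => h; have [s t] := decaying_angleP mu.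
have sX := ltW (trap_start_gt0 mu).
have := prufer_barrier0 s (sinpi R) sX h.
by have /andP[_] := t _ (lexx _); have := pi_gt0 R; lra.
Qed.

(** Backward comparison from the trap gives the weak inequality. Equality at 0 would make both
    angles agree on []0, X[]; as the rates differ by [(mu' - mu) sin^2], the sine would vanish
    there, which is impossible because the rate is 1 at such angles. *)
Lemma eigen_phase_lt mu mu' : mu < mu' -> eigen_phase mu < eigen_phase mu'.
Proof.
move=> mm; have t1 := decaying_angleP mu; have t2 := decaying_angleP mu'.
rewrite ltrN2; set th := decaying_angle mu in t1 *; set ph := decaying_angle mu' in t2 *.
set X := trap_start mu'; have X_gt0 : 0 < X := trap_start_gt0 mu'.
have /andP[DX _] := trapped_le (ltW mm) t1 t2 (lexx X); rewrite subr_ge0 in DX.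
have back x : 0 <= x <= X -> ph x <= th x.
  by move=> /andP[_ xX]; exact: (prufer_backward QM (ltW mm) t1.1 t2.1 xX).
rewrite lt_neqAle back ?lexx ?ltW // andbT; apply/eqP => e0.
have eq x : 0 < x < X -> th x - ph x = 0.
  move=> /andP[x0 xX]; have h : 0 <= x <= X by rewrite !ltW.
  apply/eqP; rewrite subr_eq0 eq_le (back x h) andbT.
  by apply: (prufer_forward QM (ltW mm) t1.1 t2.1 (ltW x0)); rewrite e0.
have sin_ph x : 0 < x < X -> sin (ph x) = 0.
  move=> x0X; have d1 := t1.1 x; have d2 := t2.1 x.
  have : is_derive x 1 (fun y => th y - ph y)
      (prufer Q mu x (th x) - prufer Q mu' x (ph x)) by der; ring.
  move=> /(derive_locally_cst eq x0X).
  have := eq x x0X => /eqP; rewrite subr_eq0 => /eqP ->.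
  rewrite (prufer_muE _ mu mu') opprD addNKr => /eqP.
  rewrite oppr_eq0 mulf_eq0 subr_eq0 (gt_eqF mm) /= expf_eq0 /=.
  by move=> /eqP.
have mid : 0 < X / 2 < X by lra.
have d2 := t2.1 (X / 2).
have : is_derive (X / 2) 1 (fun y => sin (ph y)) (cos (ph (X / 2)) * prufer Q mu' (X / 2) (ph (X / 2))).
  by der; ring.
move=> /(derive_locally_cst sin_ph mid); rewrite /prufer sin_ph //.
rewrite mulr0 addr0 expr0n mulr0 subr0 => /eqP; rewrite -exprS expf_eq0 /= => /eqP c0.
have := cos2Dsin2 (ph (X / 2)); rewrite c0 sin_ph // expr0n addr0 => /eqP.
by rewrite eq_sym oner_eq0.
Qed.

Lemma eigen_phase_continuous : continuous eigen_phase.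
Proof.
(* One [X] serves every [mu] within 1 of [mu0]. In [K] below, [5 = 2 ^ 2 + 1]: the angles at [X]
   differ by at most [2 d] by [trapped_le], and the rates by at most [d]. *)
move=> mu0; pose X := trap_start (mu0 + 1).
have X_gt0 : 0 < X := trap_start_gt0 _.
pose L := prufer_rate M 0 0 X + 2 * (`|mu0| + 1).
pose K := 5 * expR ((2 * L + 1) * (X - 0)).
have K0 : 0 <= K by rewrite mulr_ge0 ?expR_ge0.
have lip mu : `|mu0 - mu| < 1 -> `|eigen_phase mu0 - eigen_phase mu| <= (K + 1) * `|mu0 - mu|.
  move=> hm; set d := `|mu0 - mu|; have d0 : 0 <= d by exact: normr_ge0.
  have [t0 t1] := (decaying_angleP mu0, decaying_angleP mu).
  set th := decaying_angle mu0 in t0; set ph := decaying_angle mu in t1.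
  have mu01 : mu0 <= mu0 + 1 by lra.
  have mu1 : mu <= mu0 + 1 by move: hm; rewrite ltr_norml; lra.
  have dX : `|th X - ph X| <= 2 * d.
    rewrite /d; have [mm|/ltW mm] := leP mu0 mu.
      have := trapped_le mm t0 t1 (trap_start_mono mu1); rewrite -/X.
      by rewrite ler_norml (ler0_norm (_ : mu0 - mu <= 0)); lra.
    have := trapped_le mm t1 t0 (trap_start_mono mu01); rewrite -/X.
    by rewrite ler_norml (ger0_norm (_ : 0 <= mu0 - mu)); lra.
  have hd x : 0 <= x <= X -> `|prufer Q mu0 x (ph x) - prufer Q mu x (ph x)| <= d.
    move=> _; rewrite (prufer_muE _ mu0 mu) opprD addNKr normrN normrM distrC.
    rewrite -[leRHS]mulr1; apply: ler_pM => //.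
    by rewrite normrX expr_le1 ?abs_sin_le1.
  have [_ H] := prufer_stable QM d0 t0.1 t1.1 hd (ltW X_gt0).
  have mb : `|mu0| <= `|mu0| + 1 by lra.
  have HK : (th 0 - ph 0) ^+ 2 <= K * d ^+ 2.
    have : (th 0 - ph 0) ^+ 2 <= ((th X - ph X) ^+ 2 + d ^+ 2) *
       expR ((2 * prufer_rate M mu0 0 X + 1) * (X - 0)) by have := sqr_ge0 d; lra.
    move=> /le_trans; apply; rewrite /K mulrAC.
    apply: ler_pM; rewrite ?expR_ge0 ?addr_ge0 ?sqr_ge0 //.
      have : (th X - ph X) ^+ 2 <= (2 * d) ^+ 2.
        by rewrite -real_normK ?num_real // ler_pXn2r ?nnegrE // mulr_ge0.
      by rewrite !expr2; lra.
    rewrite ler_expR; apply: ler_wpM2r; first by lra.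
    by rewrite lerD2r ler_pM2l // /L /prufer_rate normr0; lra.
  rewrite /eigen_phase -/th -/ph -(@ler_pXn2r _ 2) ?nnegrE ?mulr_ge0 ?addr_ge0 //.
  rewrite real_normK ?num_real // exprMn -opprD sqrrN.
  apply: (le_trans HK); apply: ler_wpM2r; first exact: sqr_ge0.
  by rewrite expr2; nra.
apply/cvgrPdist_lt => e e0; near=> mu.
have m1 : `|mu0 - mu| < 1 by near: mu; exists 1 => //=.
apply: (le_lt_trans (lip mu m1)).
rewrite mulrC -ltr_pdivlMr; last by lra.
by near: mu; exists (e / (K + 1)) => //=; rewrite divr_gt0 //; lra.
Unshelve. all: by end_near. Qed.

End TrappedSolutions.

Section LinearEquation.
Context {R : realType}.

Lemma contN (f : R -> R) : continuous f -> continuous (fun x => - f x).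
Proof. by move=> cf x; apply: cvgN; exact: cf. Qed.

Lemma contV (f : R -> R) : (forall x, f x != 0) -> continuous f ->
  continuous (fun x => (f x)^-1).
Proof. by move=> f0 cf x; apply: cvgV; [exact: f0|exact: cf]. Qed.

Lemma cont_sin (f : R -> R) : continuous f -> continuous (fun x => sin (f x)).
Proof. by move=> cf x; apply: continuous_comp; [exact: cf|exact: continuous_sin]. Qed.

Lemma cont_cos (f : R -> R) : continuous f -> continuous (fun x => cos (f x)).
Proof. by move=> cf x; apply: continuous_comp; [exact: cf|exact: continuous_cos]. Qed.

(** Used for two consequences: a solution that is zero at [a] stays zero, one that is positive at
    [a] stays positive. *)
Lemma linear_solution (l e : R -> R) (a b : R) : continuous l -> a <= b ->
  (forall x, a <= x <= b -> is_derive x 1 e (l x * e x)) ->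
  e b = e a * expR (prim l b - prim l a).
Proof.
move=> cl ab de.
have H x : a <= x <= b -> is_derive x 1 (fun y => e y * expR (- prim l y)) 0.
  by move=> xab; have d1 := de x xab; have d2 := prim_derive cl x; der; ring.
have := derive0_eq ab H => E; rewrite expRD mulrCA mulrC E -mulrA -expRD.
by rewrite addNr expR0 mulr1.
Qed.

End LinearEquation.

(** * Liouville-Green angle for a continuous potential *)

Section LiouvilleGreen.
Context {R : realType}.
Variables (Q q G g : R -> R) (N mu : R).
Hypothesis dQ : forall x : R, is_derive x 1 Q (q x).
Hypothesis cq : continuous q.
Hypothesis dG : forall x : R, is_derive x 1 G (g x).
Hypothesis qg : forall x, `|q x| <= g x.
Hypothesis GN : forall x, 0 <= G x <= N.
Hypothesis mu1 : 1 <= mu.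
Implicit Types (x : R).

(** The truncation at 1 keeps the coefficients continuous on the whole line, as [picard] requires;
    on [[0, mu - 1]] it changes nothing. *)
Let s x : R := Num.max (mu - x) 1.
Let p x : R := Num.sqrt (s x).
(** The remainder of the Liouville transform, where [v_zz = - (1 + k / p) v] as long as
    [s = mu - x]; 5/16 is [1/4 * 5/4], from differentiating [s^(-1/4)] twice. *)
Let k x : R := (5 / 16 / s x ^+ 2 - q x) / p x.

Let s1 x : 1 <= s x. Proof. by rewrite le_max lexx orbT. Qed.
Let s0 x : 0 < s x. Proof. exact: lt_le_trans (s1 x). Qed.
Let p0 x : 0 < p x. Proof. by rewrite sqrtr_gt0. Qed.
Let p1 x : 1 <= p x. Proof. by rewrite -[leLHS]sqrtr1; apply: ler_wsqrtr. Qed.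
Let p2 x : p x ^+ 2 = s x. Proof. by rewrite sqr_sqrtr // ltW. Qed.

Let cs : continuous s.
Proof.
move=> x; apply: (@continuous_max _ _ (fun x => mu - x) (fun=> 1)); last exact: cst_continuous.
by apply: cvgB; [exact: cvg_cst|exact: cvg_id].
Qed.

Let cp : continuous p.
Proof. by move=> x; apply: continuous_comp; [exact: cs|exact: sqrt_continuous]. Qed.

Let ck : continuous k.
Proof.
apply: contM; last by apply: contV => // x; rewrite gt_eqF.
apply: contD; last exact: contN.
apply: contM; first exact: cont_cst.
apply: contV; first by move=> x; rewrite gt_eqF ?exprn_gt0.
by under [X in continuous X]eq_fun do rewrite expr2; exact: contM.
Qed.

Let sE x : x <= mu - 1 -> s x = mu - x.
Proof. by move=> h; rewrite /s; apply/max_idPl; lra. Qed.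

(* The angle of [(p u, u' - u / (4 s))], i.e. of [(v, v_z)] for the Liouville transform
   [u = s^(-1/4) v], [z' = p]. *)
Lemma green_angle_exists (a0 : R) : exists2 eta : R -> R, eta 0 = a0 &
  forall x, is_derive x 1 eta (p x + k x * sin (eta x) ^+ 2).
Proof.
apply: (@picard _ (fun x a => p x + k x * sin a ^+ 2) (fun x => 2 * `|k x|)).
- move=> th cth; apply: contD => //; apply: contM => //.
  by under [X in continuous X]eq_fun do rewrite expr2; apply: contM; exact: cont_sin.
- by apply: contM; [exact: cont_cst|exact: cont_norm].
move=> x a b.
rewrite (_ : _ - _ = k x * (sin a ^+ 2 - sin b ^+ 2)); last by ring.
rewrite normrM -mulrA mulrCA; apply: ler_wpM2l => //.
wlog ab : a b / a < b.
  move=> H; have [/H//|/H|e] := ltgtP a b; first by rewrite distrC (distrC b).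
  by rewrite e !subrr normr0 mulr0.
have D (y : R) : is_derive y 1 (fun y => sin y ^+ 2) (2 * sin y * cos y) by der; ring.
have [c _ e] := mvt ab (fun y _ => D y).
rewrite distrC e normrM (distrC a) ler_wpM2r // -mulrA normrM ger0_norm //.
by rewrite ler_piMr // normrM mulr_ile1 // ?abs_sin_le1 ?abs_cos_le1.
Qed.

(** The term [p] integrates to exactly [2/3 mu^(3/2) - 2/3]. Since [p >= 1], the other term is at
    most [(mu - x)^-2 + g], and stopping at [mu - 1] keeps the integral of [(mu - x)^-2] below 1. *)
Lemma green_angle_growth (eta : R -> R) :
  (forall x, is_derive x 1 eta (p x + k x * sin (eta x) ^+ 2)) ->
  `|eta (mu - 1) - eta 0 - (2 / 3 * mu * Num.sqrt mu - 2 / 3)| <= 1 + N.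
Proof.
move=> deta; have b0 : 0 <= mu - 1 by rewrite subr_ge0.
pose P x := - (2 / 3 * (mu - x) * Num.sqrt (mu - x)).
have dP x : 0 <= x <= mu - 1 -> is_derive x 1 P (p x).
  move=> /andP[_ xb]; have mx : 0 < mu - x by lra.
  rewrite /P; der; rewrite /p sE //.
  have q0 : Num.sqrt (mu - x) != 0 by rewrite gt_eqF ?sqrtr_gt0.
  rewrite -{3}(sqr_sqrtr (ltW mx)); field; exact: q0.
pose W x := (mu - x)^-1 + G x.
have dW x : 0 <= x <= mu - 1 -> is_derive x 1 W ((mu - x) ^- 2 + g x).
  move=> /andP[_ xb]; have mx : mu - x != 0 by rewrite gt_eqF //; lra.
  by have D := dG x; rewrite /W; der; field.
have kb x : 0 <= x <= mu - 1 -> `|k x * sin (eta x) ^+ 2| <= (mu - x) ^- 2 + g x.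
  move=> /andP[_ xb]; rewrite -(sE xb) normrM.
  have sn : `|sin (eta x) ^+ 2| <= 1 by rewrite normrX expr_le1 ?abs_sin_le1.
  apply: (@le_trans _ _ `|k x|); first by rewrite ler_piMr.
  rewrite /k normrM normfV (gtr0_norm (p0 x)) ler_pdivrMr //.
  have g0 : 0 <= g x := le_trans (normr_ge0 _) (qg x).
  have v0 : 0 < s x ^- 2 by rewrite invr_gt0 exprn_gt0.
  apply: (@le_trans _ _ (s x ^- 2 + g x)); last by rewrite ler_peMr // addr_ge0 // ltW.
  apply: (le_trans (ler_normB _ _)); apply: lerD => //.
  by rewrite ger0_norm; [move: v0; set v := _ ^- 2; lra|rewrite mulr_ge0 // ltW].
have up := @derive_le _ (fun y => eta y - P y) W 0 (mu - 1)
   (fun x => k x * sin (eta x) ^+ 2) _ b0 _ dW.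
have dn := @derive_le _ (fun y => P y - eta y) W 0 (mu - 1)
   (fun x => - (k x * sin (eta x) ^+ 2)) _ b0 _ dW.
have {}up : eta (mu - 1) - P (mu - 1) - (eta 0 - P 0) <= W (mu - 1) - W 0.
  apply: up => x xab; first by have d1 := deta x; have d2 := dP x xab; der; ring.
  have h : 0 <= x <= mu - 1 by lra.
  by have := kb x h; rewrite ler_norml => /andP[].
have {}dn : P (mu - 1) - eta (mu - 1) - (P 0 - eta 0) <= W (mu - 1) - W 0.
  apply: dn => x xab; first by have d1 := deta x; have d2 := dP x xab; der; ring.
  have h : 0 <= x <= mu - 1 by lra.
  by have := kb x h; rewrite ler_norml => /andP[]; lra.
have WN : W (mu - 1) - W 0 <= 1 + N.
  rewrite /W subKr subr0 invr1; have /andP[_ h1] := GN (mu - 1).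
  have /andP[h2 _] := GN 0; have : 0 <= mu^-1 by rewrite invr_ge0; lra.
  lra.
move: up dn; rewrite /P subKr subr0 sqrtr1 ler_norml; lra.
Qed.

(** The map from [(u, u1)] to [(p u, u' - u / (4 s))] is triangular with positive diagonal, so it
    sends no vector to a negative multiple of itself. Hence the two angles never differ by [pi] or
    [- pi], and by continuity they stay within pi once they start so. *)
Lemma green_angle_close (th : R -> R) : prufer_solution Q mu th ->
  exists2 eta : R -> R, (forall x, is_derive x 1 eta (p x + k x * sin (eta x) ^+ 2)) &
    forall x, 0 <= x <= mu - 1 -> `|eta x - th x| <= pi.
Proof.
move=> sth; have pi0 := pi_gt0 R; have b0 : 0 <= mu - 1 by rewrite subr_ge0.
pose X x := Num.sqrt (mu - x) * sin (th x).
pose Y x := cos (th x) + (Q x - 1 / (4 * (mu - x))) * sin (th x).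
(* Up to a positive factor, [A] and [B] are the cosine and sine of the angle from the direction [th]
   to the vector [(X, Y)]. *)
pose A x := X x * sin (th x) + Y x * cos (th x).
pose B x := X x * cos (th x) - Y x * sin (th x).
have BA x : x <= mu - 1 -> B x = 0 -> 0 < A x.
  move=> xb; have mx : 0 < mu - x by lra.
  rewrite /B /A /X /Y => /eqP.
  rewrite (_ : _ - _ = sin (th x) * ((Num.sqrt (mu - x) - 1) * cos (th x) -
     (Q x - 1 / (4 * (mu - x))) * sin (th x))); last by ring.
  have cs1 := cos2Dsin2 (th x).
  rewrite mulf_eq0 => /orP[/eqP e|].
    by move: cs1; rewrite e !mulr0 addr0 add0r expr0n addr0 -expr2 => ->.
  rewrite subr_eq0 => /eqP <-.
  rewrite (_ : _ + _ = Num.sqrt (mu - x) * (cos (th x) ^+ 2 + sin (th x) ^+ 2)); last by ring.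
  by rewrite cs1 mulr1 sqrtr_gt0.
(* [E = 0] together with [F > 0] says that [eta] is an angle of [(X, Y)]. *)
pose E (eta : R -> R) x := sin (eta x) * Y x - cos (eta x) * X x.
pose F (eta : R -> R) x := sin (eta x) * X x + cos (eta x) * Y x.
(* [d] is the angle between the two directions at 0. As [h 0] is opposite to [h pi] and [h (- pi)],
   the intermediate value theorem gives a zero on the side where [sin d] has the sign of [B 0],
   which selects the direction and not its opposite. *)
have [d [d1 d2 Ed Fd]] : exists d : R, [/\ - pi < d, d < pi,
    sin d * A 0 - cos d * B 0 = 0 & 0 < sin d * B 0 + cos d * A 0].
  pose h (d : R) := sin d * A 0 - cos d * B 0.
  have ch : continuous h.
    by apply: contD; [apply: contM|apply: contN; apply: contM];
       try exact: cont_cst; [exact: continuous_sin|exact: continuous_cos].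
  have key d : sin d != 0 -> h d = 0 -> sin d * B 0 + cos d * A 0 = B 0 / sin d.
    move=> sd /eqP; rewrite subr_eq0 => /eqP e.
    apply: (mulIf sd); rewrite mulfVK //.
    rewrite (_ : _ * sin d = sin d ^+ 2 * B 0 + cos d * (sin d * A 0)); last by ring.
    rewrite e.
    by rewrite -[RHS]mul1r -(cos2Dsin2 d); ring.
  have h0 : h 0 = - B 0 by rewrite /h sin0 cos0; ring.
  have hp : h pi = B 0 by rewrite /h sinpi cospi; ring.
  have hn : h (- pi) = B 0 by rewrite /h sinN cosN sinpi cospi; ring.
  have [Bp|Bn|B0] := ltgtP 0 (B 0).
  - have [||d /[!in_itv]/= /andP[d1 d2] hd] := @IVT _ h 0 pi 0 (ltW pi0).
      by apply: continuous_subspaceT.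
      by rewrite h0 hp ge_min le_max; lra.
    have dne0 : d != 0 by apply: contra_eqN hd => /eqP ->; rewrite h0 oppr_eq0 gt_eqF.
    have dnep : d != pi by apply: contra_eqN hd => /eqP ->; rewrite hp gt_eqF.
    have sd : 0 < sin d.
      by apply: sin_gt0_pi; rewrite !lt_neqAle d1 d2 dnep eq_sym dne0.
    exists d; split=> //; first by lra.
      by rewrite lt_neqAle dnep.
    by rewrite (key d) ?gt_eqF // divr_gt0.
  - have mp : - pi <= (0 : R) by lra.
    have [||d /[!in_itv]/= /andP[d1 d2] hd] := @IVT _ h (- pi) 0 0 mp.
      by apply: continuous_subspaceT.
      by rewrite h0 hn ge_min le_max; lra.
    have dne0 : d != 0 by apply: contra_eqN hd => /eqP ->; rewrite h0 oppr_eq0 lt_eqF.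
    have dnep : d != - pi by apply: contra_eqN hd => /eqP ->; rewrite hn lt_eqF.
    have dlt : - pi < d by rewrite lt_neqAle d1 eq_sym dnep.
    have dl0 : d < 0 by rewrite lt_neqAle d2 dne0.
    have sd : sin d < 0.
      rewrite -[d]opprK sinN oppr_lt0; apply: sin_gt0_pi; lra.
    exists d; split=> //; first by lra.
    by rewrite (key d) ?lt_eqF // ltr_ndivlMr // mul0r.
  - exists 0; split; rewrite ?sin0 ?cos0 -?B0; try lra.
    by rewrite mul0r add0r mul1r BA.
have [eta eta0 deta] := green_angle_exists (th 0 + d); exists eta => //.
(* The logarithmic derivative of the radius of [(u, u1)]; it appears because [X] and [Y] are built
   from the normalized pair [(sin th, cos th)]. *)
pose rho x := (1 + (x - mu) - Q x ^+ 2) * (sin (th x) * cos (th x)) +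
  Q x * (sin (th x) ^+ 2 - cos (th x) ^+ 2).
have ceta : continuous eta by exact: derive_cont deta.
have cth : continuous th by exact: derive_cont sth.
have cQ : continuous Q by exact: derive_cont dQ.
have crho : continuous rho.
  rewrite /rho; under [Z in continuous Z]eq_fun do rewrite !expr2.
  have cS := cont_sin cth; have cC := cont_cos cth.
  apply: contD.
    apply: contM; last exact: contM.
    apply: contD; last by apply: contN; exact: contM.
    apply: contD; first exact: cont_cst.
    by apply: contD; [move=> x; exact: cvg_id|exact: cont_cst].
  by apply: contM => //; apply: contD; [|apply: contN]; exact: contM.
have cV : continuous (fun x => 1 / (4 * s x)).
  apply: contM; first exact: cont_cst.
  by apply: contV; [move=> x; rewrite gt_eqF ?mulr_gt0|apply: contM => //; exact: cont_cst].
pose l x := k x * (sin (eta x) * cos (eta x)).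
have cl : continuous l.
  by apply: contM => //; apply: contM; [exact: cont_sin|exact: cont_cos].
pose lE x := l x - 1 / (4 * s x) - rho x.
pose lF x := - l x - 1 / (4 * s x) - rho x.
have clE : continuous lE by apply: contD; [apply: contD|]; try exact: contN.
have clF : continuous lF.
  by apply: contD; [apply: contD|]; try exact: contN.
pose kap x := 1 / (4 * s x) + rho x.
have lEE x : lE x = l x - kap x by rewrite /lE /kap; ring.
have lFE x : lF x = - l x - kap x by rewrite /lF /kap; ring.
have dX x : 0 <= x <= mu - 1 -> is_derive x 1 X (p x * Y x - kap x * X x).
  move=> /andP[_ xb]; have mx : 0 < mu - x by lra.
  have dth := sth x; rewrite {1}/X; der.
  rewrite /prufer /X /Y /kap /rho /p (sE xb).
  have q0 : Num.sqrt (mu - x) != 0 by rewrite gt_eqF ?sqrtr_gt0.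
  have q2 := sqr_sqrtr (ltW mx); have cs1 := cos2Dsin2 (th x).
  have -> : x - mu = - Num.sqrt (mu - x) ^+ 2 by rewrite q2; ring.
  rewrite -[in 4 * (mu - x)]q2; move: (Num.sqrt (mu - x)) q0 => r r0.
  move: (sin (th x)) (cos (th x)) (Q x) cs1 => S C Z cs1.
  apply/eqP; rewrite -subr_eq0; apply/eqP.
  rewrite (_ : _ - _ = r * (C + Z * S) * (C ^+ 2 + S ^+ 2 - 1)); last by field.
  by rewrite cs1 subrr mulr0.
have dY x : 0 <= x <= mu - 1 -> is_derive x 1 Y (- (p x + k x) * X x - kap x * Y x).
  move=> /andP[_ xb]; have mx : 0 < mu - x by lra.
  have dth := sth x; have dq := dQ x; have m4 : 4 * (mu - x) != 0 by rewrite gt_eqF ?mulr_gt0.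
  rewrite {1}/Y; der.
  rewrite /prufer /X /Y /kap /rho /k /p (sE xb).
  have q0 : Num.sqrt (mu - x) != 0 by rewrite gt_eqF ?sqrtr_gt0.
  have q2 := sqr_sqrtr (ltW mx); have cs1 := cos2Dsin2 (th x).
  have -> : x - mu = - Num.sqrt (mu - x) ^+ 2 by rewrite q2; ring.
  have e4 : 4 * (mu - x) = 4 * Num.sqrt (mu - x) ^+ 2 by rewrite q2.
  have e5 : (mu - x) ^+ 2 = Num.sqrt (mu - x) ^+ 4 by rewrite -{1}q2 -exprM.
  rewrite e4 e5; move: (Num.sqrt (mu - x)) q0 => r r0.
  move: (sin (th x)) (cos (th x)) (Q x) (q x) cs1 => S C Z z cs1.
  apply/eqP; rewrite -subr_eq0; apply/eqP.
  rewrite (_ : _ - _ = (C ^+ 2 + S ^+ 2 - 1) * ((Z - 1 / (4 * r ^+ 2)) * (C + Z * S)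
    - (Z * C + Z ^+ 2 * S + r ^+ 2 * S))); last by field.
  by rewrite cs1 subrr mul0r.
(* [E] solves a homogeneous linear equation and so stays 0; once [E = 0], [F] solves one too and so
   stays positive. *)
have dE x : 0 <= x <= mu - 1 -> is_derive x 1 (E eta) (lE x * E eta x).
  move=> xb; have d1' := dX x xb; have d2' := dY x xb; have d3 := deta x.
  rewrite {1}/E; der; rewrite /E lEE /l.
  have cs1 := cos2Dsin2 (eta x).
  move: (sin (eta x)) (cos (eta x)) cs1 (X x) (Y x) (kap x) (p x) (k x).
  move=> S C cs1 x1 y1 kk pp gg; apply/eqP; rewrite -subr_eq0; apply/eqP.
  rewrite (_ : _ - _ = gg * S * x1 * (C ^+ 2 + S ^+ 2 - 1)); last by ring.
  by rewrite cs1 subrr mulr0.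
have E0x x : 0 <= x <= mu - 1 -> E eta x = 0.
  move=> /andP[x0 xb].
  have dx y : 0 <= y <= x -> is_derive y 1 (E eta) (lE y * E eta y).
    by move=> /andP[y0 yx]; apply: dE; rewrite y0 (le_trans yx).
  rewrite (linear_solution clE x0 dx).
  rewrite (_ : E eta 0 = 0) ?mul0r // -[RHS]Ed /E eta0 sinD cosD /A /B; ring.
have dF x : 0 <= x <= mu - 1 -> is_derive x 1 (F eta) (lF x * F eta x).
  move=> xb; have d1' := dX x xb; have d2' := dY x xb; have d3 := deta x.
  have e0 := E0x x xb; rewrite {1}/F; der; rewrite /F lFE /l.
  have cs1 := cos2Dsin2 (eta x); move: e0; rewrite /E.
  move: (sin (eta x)) (cos (eta x)) cs1 (X x) (Y x) (kap x) (p x) (k x).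
  move=> S C cs1 x1 y1 kk pp gg e0; apply/eqP; rewrite -subr_eq0; apply/eqP.
  rewrite (_ : _ - _ = (S * y1 - C * x1) * (gg * (C ^+ 2 - S ^+ 2))
     + gg * C * x1 * (C ^+ 2 + S ^+ 2 - 1)); last by ring.
  by rewrite cs1 e0 subrr mulr0 mul0r addr0.
have F0x x : 0 <= x <= mu - 1 -> 0 < F eta x.
  move=> /andP[x0 xb].
  have dx y : 0 <= y <= x -> is_derive y 1 (F eta) (lF y * F eta y).
    by move=> /andP[y0 yx]; apply: dF; rewrite y0 (le_trans yx).
  rewrite (linear_solution clF x0 dx).
  rewrite mulr_gt0 ?expR_gt0 //; move: Fd; congr (_ < _).
  rewrite /F eta0 sinD cosD /A /B; ring.
pose D x := eta x - th x.
have cD : continuous D by apply: contD => //; exact: contN.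
have Dne x e : 0 <= x <= mu - 1 -> sin e = 0 -> cos e = -1 -> D x != e.
  move=> xb se ce; apply/eqP => De.
  have ex : eta x = th x + e by rewrite -De /D; ring.
  have := F0x x xb; have := E0x x xb; rewrite /E /F ex sinD cosD se ce.
  move=> h1 h2; have /andP[_ xb'] := xb; have := BA x xb' => BAx.
  have : B x = 0 by rewrite -[RHS]h1 /B; ring.
  by move/BAx; move: h2; rewrite /A; lra.
have D0 : D 0 = d by rewrite /D eta0; ring.
move=> x /andP[x0 xb]; rewrite -/(D x) ler_norml; apply/andP; split.
  rewrite leNgt; apply/negP => h.
  have [||c /[!in_itv]/= /andP[c0 cx] Dc] := @IVT _ D 0 x (- pi) x0.
  - exact: continuous_subspaceT.
  - by rewrite D0 ge_min le_max; lra.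
  have := @Dne c (- pi); rewrite Dc eqxx sinN cosN sinpi cospi oppr0 c0 (le_trans cx) //.
  by move=> /(_ isT erefl erefl).
rewrite leNgt; apply/negP => h.
have [||c /[!in_itv]/= /andP[c0 cx] Dc] := @IVT _ D 0 x pi x0.
- exact: continuous_subspaceT.
- by rewrite D0 ge_min le_max; lra.
have := @Dne c pi; rewrite Dc eqxx sinpi cospi c0 (le_trans cx) //.
by move=> /(_ isT erefl erefl).
Qed.

Lemma smooth_prufer_growth (th : R -> R) : prufer_solution Q mu th ->
  `|th (mu - 1) - th 0 - 2 / 3 * mu * Num.sqrt mu| <= 2 * pi + N + 2.
Proof.
move=> sth; have [eta deta close] := green_angle_close sth.
have b0 : 0 <= mu - 1 by rewrite subr_ge0.
have := green_angle_growth deta.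
have := close 0; rewrite lexx b0 => /(_ isT).
have := close (mu - 1); rewrite lexx b0 => /(_ isT).
by rewrite !ler_norml; lra.
Qed.

End LiouvilleGreen.

(** * From continuous to integrable potentials by averaging *)

Section RoughPotential.
Context {R : realType}.
Variables (Q G : R -> R) (M N X0 : R).
Hypothesis cQ : continuous Q.
Hypothesis QM : forall x, `|Q x| <= M.
Hypothesis cG : continuous G.
Hypothesis GN : forall x, 0 <= G x <= N.
Hypothesis QG : forall x y, x <= y -> `|Q y - Q x| <= G y - G x.
Implicit Types (x mu : R).

(** Unlike [gronwall], this charges a perturbation by its integral. That suits averaging: the bound
    [G (x + h) - G x] on the error has no explicit uniform rate in [h], but its integral is at most
    [h N]. *)
Lemma gronwall_forward (D g K k : R -> R) (L a b : R) : a <= b -> 0 <= L ->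
  (forall x, a <= x <= b -> is_derive x 1 D (g x)) ->
  (forall x, a <= x <= b -> is_derive x 1 K (k x)) ->
  (forall x, a <= x <= b -> 0 <= k x) ->
  (forall x, a <= x <= b -> `|g x| <= L * `|D x| + k x) ->
  D a = 0 -> `|D b| <= expR (L * (b - a)) * (K b - K a).
Proof.
move=> ab L0 dD dK k0 gD Da.
pose H x := expR (L * (x - a)) * (K x - K a).
have Kmono x : a <= x <= b -> 0 <= K x - K a.
  move=> /andP[ax xb]; rewrite subr_ge0; apply: (@derive_ge0_le _ K k) => //.
    by move=> y /andP[ay yx]; apply: dK; rewrite ay (le_trans yx).
  by move=> y /andP[ay yx]; apply: k0; lra.
have H0 x : a <= x <= b -> 0 <= H x.
  by move=> /Kmono h; rewrite mulr_ge0 ?expR_ge0.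
have dH x : a <= x <= b -> is_derive x 1 H (L * H x + expR (L * (x - a)) * k x).
  by move=> xab; have d1 := dK x xab; rewrite /H; der; ring.
have ek x : a <= x <= b -> k x <= expR (L * (x - a)) * k x.
  move=> xab; rewrite ler_peMl ?k0 //; have := expR_ge1Dx (L * (x - a)).
  by have := mulr_ge0 L0 (_ : 0 <= x - a); rewrite subr_ge0; move: xab => /andP[-> _] /(_ isT); lra.
have Ha : H a = 0 by rewrite /H !subrr mulr0.
have up : D b - H b <= 0.
  apply: (@comparison_forward _ (fun y => D y - H y)
    (fun x => g x - (L * H x + expR (L * (x - a)) * k x)) L a b ab).
  - by move=> x xab; have d1 := dD x xab; have d2 := dH x xab; der; ring.
  - move=> x xab pos; have := gD x xab; have := H0 x xab; have := ek x xab => h1 h2.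
    have D0 : 0 <= D x by lra.
    by rewrite (ger0_norm D0) ler_norml => /andP[_]; lra.
  - by rewrite Da Ha subrr.
have dn : - D b - H b <= 0.
  apply: (@comparison_forward _ (fun y => - D y - H y)
    (fun x => - g x - (L * H x + expR (L * (x - a)) * k x)) L a b ab).
  - by move=> x xab; have d1 := dD x xab; have d2 := dH x xab; der; ring.
  - move=> x xab pos; have := gD x xab; have := H0 x xab; have := ek x xab => h1 h2.
    have D0 : D x <= 0 by lra.
    by rewrite (ler0_norm D0) ler_norml => /andP[+ _]; lra.
  - by rewrite Da Ha !oppr0 addr0.
by rewrite ler_norml -/(H b); lra.
Qed.

(** The Steklov mean of [f] over [[x, x + h]]. *)
Definition average (h : R) (f : R -> R) x : R := (prim f (x + h) - prim f x) / h.

Lemma average_derive h f x : continuous f ->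
  is_derive x 1 (average h f) ((f (x + h) - f x) / h).
Proof.
move=> cf; rewrite /average; have d1 := prim_derive cf x.
have d2 : is_derive x 1 (fun y => prim f (y + h)) (f (x + h)).
  have := @dcomp _ (prim f) (fun y => y + h) _ _ _
    (prim_derive cf (x + h)) (dadd (did x) (dcst x h)).
  by move=> d2; apply: (deq d2); ring.
by der; rewrite mulr0 addr0.
Qed.

Lemma average_mean h f x : 0 < h -> continuous f ->
  exists2 c, x < c < x + h & average h f x = f c.
Proof.
move=> h0 cf; have xh : x < x + h by rewrite ltrDl.
have [c cx e] := mvt xh (fun y _ => prim_derive cf y).
by exists c => //; rewrite /average e addrAC subrr add0r mulfK // gt_eqF.
Qed.

(** The means of [Q] and [G] meet the smooth hypotheses with the same [N] for every width. So [h]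
    can be chosen after [mu], small enough to move the angle at [mu - 1] by at most 1. *)
Lemma prufer_growth mu th : 1 <= mu -> prufer_solution Q mu th ->
  `|th (mu - 1) - th 0 - 2 / 3 * mu * Num.sqrt mu| <= 2 * pi + N + 3.
Proof.
move=> mu1 sth; have b0 : 0 <= mu - 1 by rewrite subr_ge0.
have M0 : 0 <= M := le_trans (normr_ge0 _) (QM 0).
have N0 : 0 <= N by have /andP[h1 h2] := GN 0; exact: le_trans h2.
set L := prufer_rate M mu 0 (mu - 1); set e := expR (L * (mu - 1 - 0)).
have L0 : 0 <= L by exact: prufer_rate_ge0.
(* The rates for [Q] and its mean differ by a difference of two squares, whose sum factor is at most
   [2 + 2 M]. *)
pose c := e * (2 + 2 * M) * N.
have c0 : 0 <= c by rewrite !mulr_ge0 ?expR_ge0 // addr_ge0 // mulr_ge0.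
have [h h0 hc] : exists2 h : R, 0 < h & c * h <= 1.
  exists (1 + c)^-1; first by rewrite invr_gt0; lra.
  by rewrite ler_pdivrMr; lra.
pose Qt := average h Q; pose Gt := average h G.
have dQt x : is_derive x 1 Qt ((Q (x + h) - Q x) / h) by exact: average_derive.
have dGt x : is_derive x 1 Gt ((G (x + h) - G x) / h) by exact: average_derive.
have cQt : continuous Qt by exact: derive_cont dQt.
have cq : continuous (fun x => (Q (x + h) - Q x) / h).
  apply: contM; last exact: cont_cst.
  apply: contD; last exact: contN.
  move=> x; apply: continuous_comp; last exact: cQ.
  by apply: cvgD; [exact: cvg_id|exact: cvg_cst].
have qg x : `|(Q (x + h) - Q x) / h| <= (G (x + h) - G x) / h.
  rewrite normrM normfV (gtr0_norm h0) ler_pM2r ?invr_gt0 //.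
  by apply: QG; rewrite lerDl ltW.
have GtN x : 0 <= Gt x <= N.
  by have [y _] := average_mean x h0 cG; rewrite -/Gt => ->.
have QtM x : `|Qt x| <= M.
  by have [y _] := average_mean x h0 cQ; rewrite -/Qt => ->.
have QtQ x : `|Q x - Qt x| <= G (x + h) - G x.
  have [y /andP[xy yh]] := average_mean x h0 cQ; rewrite -/Qt => ->.
  rewrite distrC; apply: (le_trans (QG (ltW xy))); rewrite lerD2r.
  by rewrite -subr_ge0; exact: le_trans (normr_ge0 _) (QG (ltW yh)).
have [tt tt0 stt] := prufer_solution_exists mu 0 (th 0) cQt.
have close : `|th (mu - 1) - tt (mu - 1)| <= 1.
  pose K x := (2 + 2 * M) * (h * Gt x).
  have dK x : is_derive x 1 K ((2 + 2 * M) * (G (x + h) - G x)).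
    by have d1 := dGt x; rewrite /K; der; field; rewrite gt_eqF.
  have k0 x : 0 <= G (x + h) - G x := le_trans (normr_ge0 _) (QtQ x).
  have := @gronwall_forward (fun y => th y - tt y)
    (fun x => prufer Q mu x (th x) - prufer Qt mu x (tt x)) K
    (fun x => (2 + 2 * M) * (G (x + h) - G x)) L 0 (mu - 1) b0 L0.
  have dD (x : R) : 0 <= x <= mu - 1 -> is_derive x 1 (fun y => th y - tt y)
    (prufer Q mu x (th x) - prufer Qt mu x (tt x)).
    by move=> _; have d1 := sth x; have d2 := stt x; der; ring.
  move=> /(_ dD (fun x _ => dK x)) H.
  have {H} : `|th (mu - 1) - tt (mu - 1)| <= e * (K (mu - 1) - K 0).
    apply: H; last by rewrite tt0 subrr.
      by move=> x _; rewrite mulr_ge0 // addr_ge0 // mulr_ge0.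
    move=> x xab.
    rewrite (_ : _ - _ = (prufer Q mu x (th x) - prufer Q mu x (tt x)) +
      (prufer Q mu x (tt x) - prufer Qt mu x (tt x))); last by ring.
    apply: (le_trans (ler_normD _ _)); apply: lerD.
      exact: prufer_lipschitz_on.
    rewrite /prufer (_ : _ - _ = (2 * cos (tt x) + (Q x + Qt x) * sin (tt x)) *
      ((Q x - Qt x) * sin (tt x))); last by ring.
    have s1 := abs_sin_le1 (tt x); have c1 := abs_cos_le1 (tt x).
    rewrite normrM; apply: ler_pM => //.
      apply: (le_trans (ler_normD _ _)); rewrite !normrM ger0_norm //; apply: lerD.
        by rewrite ler_piMr.
      rewrite -[leRHS]mulr1; apply: ler_pM => //.
      by apply: (le_trans (ler_normD _ _)); have := QM x; have := QtM x; lra.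
    by rewrite normrM -[leRHS]mulr1; apply: ler_pM.
  move=> /le_trans; apply.
  have KN : K (mu - 1) - K 0 <= (2 + 2 * M) * (h * N).
    have /andP[_ g1] := GtN (mu - 1); have /andP[g2 _] := GtN 0.
    rewrite /K -mulrBr -mulrBr; apply: ler_wpM2l; first by lra.
    by apply: ler_wpM2l; [exact: ltW|lra].
  apply: (le_trans (ler_wpM2l (expR_ge0 _) KN)).
  apply: (le_trans _ hc); rewrite le_eqVlt; apply/orP; left; apply/eqP.
  by rewrite /c /e; ring.
have := smooth_prufer_growth dQt cq dGt qg GtN mu1 stt.
by move: close; rewrite tt0 !ler_norml; lra.
Qed.

Hypothesis X01 : 1 <= X0.
Hypothesis Q4 : forall x, X0 <= x -> `|Q x| <= 1 / 4.

Theorem eigen_phase_asymptotic : exists C : R, forall mu, X0 <= mu ->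
  `|eigen_phase Q X0 mu - 2 / 3 * mu * Num.sqrt mu| <= C.
Proof.
(* [B] bounds the rate on [[mu - 1, mu + 2]], where [|x - mu| <= 2]. Crossing the turning point
   costs at most [3 B], and at [mu + 2] the angle is already in the band. *)
pose B := (1 + M) ^+ 2 + 2.
exists (3 * B + 3 * pi + N + 3) => mu Xmu.
have [sth tth] := decaying_angleP cQ QM Q4 mu.
rewrite /eigen_phase; set th := decaying_angle Q X0 mu in sth tth *.
have mu1 : 1 <= mu := le_trans X01 Xmu.
have start : trap_start X0 mu <= mu + 2.
  by rewrite /trap_start ge_max lexx andbT; lra.
have /andP[t1 t2] := tth (mu + 2) start.
have := prufer_growth mu1 sth.
have M0 : 0 <= M := le_trans (normr_ge0 _) (QM 0).
have ab : mu - 1 < mu + 2 by lra.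
have [c cab] := mvt ab (fun y _ => sth y).
have fB : `|prufer Q mu c (th c)| <= B.
  rewrite /prufer; apply: (le_trans (ler_normB _ _)); apply: lerD.
    rewrite normrX ler_pXn2r ?nnegrE ?addr_ge0 //.
    apply: (le_trans (ler_normD _ _)); apply: lerD; first exact: abs_cos_le1.
    by rewrite normrM -[leRHS]mulr1; apply: ler_pM => //; exact: abs_sin_le1.
  rewrite normrM -[leRHS]mulr1; apply: ler_pM => //.
    by rewrite ler_norml; lra.
  by rewrite normrX expr_le1 ?abs_sin_le1.
move: fB; rewrite !ler_norml; have := pi_gt0 R; lra.
Qed.

End RoughPotential.

(** * Absolutely continuous functions *)

Section AbsoluteContinuity.
Context {R : realType}.
Notation mu := (@lebesgue_measure R).
Implicit Types (f g : R -> R) (a b x : R).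

Lemma abs_cont_dist a b f : abs_cont_on a b f -> forall e, 0 < e ->
  exists2 d, 0 < d & forall x y, a <= x <= b -> a <= y <= b -> `|x - y| < d ->
    `|f x - f y| < e.
Proof.
move=> fac e e0; have [d d0 H] := fac e e0; exists d => // x y.
wlog xy : x y / x <= y.
  move=> W hx hy h; have [xy|/ltW yx] := leP x y; first exact: W.
  by rewrite distrC; apply: W => //; rewrite distrC.
move=> /andP[ax _] /andP[_ yb] h; rewrite distrC.
have := H 1%N (fun=> x) (fun=> y); rewrite !big_ord1; apply => //.
- by move=> i j; rewrite !ord1.
- by rewrite distrC ger0_norm ?subr_ge0 // in h.
Qed.

Lemma abs_cont_bounded a b f : a <= b -> abs_cont_on a b f ->
  exists2 B, 0 < B & forall x, a <= x <= b -> `|f x| <= B.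
Proof.
(* Composing with the 1-Lipschitz clamp onto [[a, b]] gives a function continuous on the line, ready
   for the extreme value theorem. *)
move=> ab fac; pose c x := Num.max a (Num.min x b).
have cab x : a <= c x <= b by rewrite le_max lexx ge_max ab ge_min lexx orbT.
have cid x : a <= x <= b -> c x = x.
  by move=> /andP[ax xb]; rewrite /c; move/min_idPl: xb => ->; apply/max_idPr.
have clip x y : `|c x - c y| <= `|x - y|.
  have maxl (u v : R) : `|Num.max a u - Num.max a v| <= `|u - v|.
    have := ler_norm (u - v); have := ler_norm (- (u - v)); rewrite normrN ler_norml.
    by rewrite /Num.max; case: ltP => ?; case: ltP => ? ? ?; lra.
  have minl (u v : R) : `|Num.min u b - Num.min v b| <= `|u - v|.
    have := ler_norm (u - v); have := ler_norm (- (u - v)); rewrite normrN ler_norml.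
    by rewrite /Num.min; case: ltP => ?; case: ltP => ? ? ?; lra.
  exact: le_trans (maxl _ _) (minl _ _).
have cf : continuous (fun x => `|f (c x)|).
  apply: cont_norm => x; apply/cvgrPdist_lt => e e0.
  have [d d0 H] := abs_cont_dist fac e0.
  near=> y; apply: H => //; apply: (le_lt_trans (clip _ _)).
  by near: y; exists d.
have [m mab M] := EVT_max ab (continuous_subspaceT cf).
exists (`|f (c m)| + 1); first by rewrite ltr_pwDr.
move=> x xab; have := M x; rewrite in_itv /= cid // xab => /(_ isT); lra.
Unshelve. all: by end_near. Qed.

Lemma abs_cont_lipschitz a b f (K : R) :
  (forall x y, a <= x -> x <= y -> y <= b -> `|f y - f x| <= K * (y - x)) ->
  abs_cont_on a b f.
Proof.
move=> fK e e0; have K1 : 0 < `|K| + 1 by rewrite ltr_pwDr.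
exists (e / (`|K| + 1)); first by rewrite divr_gt0.
move=> n u v uv _ s; apply: (@le_lt_trans _ _ (\sum_(i < n) (`|K| + 1) * (v i - u i))).
  apply: ler_sum => i _; have [h1 [h2 h3]] := uv i.
  apply: (le_trans (fK _ _ h1 h2 h3)); apply: ler_wpM2r; first by rewrite subr_ge0.
  by have := ler_norm K; lra.
by rewrite -mulr_sumr mulrC -ltr_pdivlMr.
Qed.

(** The common source of closure under differences and products, and of the absolute continuity of
    [potential_primitive] from that of [potential_var]. *)
Lemma abs_cont_dominated a b f g (K L : R) : 0 <= K -> 0 <= L ->
  forall h : R -> R, abs_cont_on a b f -> abs_cont_on a b g ->
  (forall x y, a <= x -> x <= y -> y <= b ->
    `|h y - h x| <= K * `|f y - f x| + L * `|g y - g x|) ->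
  abs_cont_on a b h.
Proof.
move=> K0 L0 h fac gac H e e0.
have e1 : 0 < e / 2 / (K + 1) by rewrite !divr_gt0 // ltr_wpDl.
have e2 : 0 < e / 2 / (L + 1) by rewrite !divr_gt0 // ltr_wpDl.
have [d1 d10 H1] := fac _ e1; have [d2 d20 H2] := gac _ e2.
exists (Num.min d1 d2); first by rewrite lt_min d10.
move=> n u v uv dis; rewrite lt_min => /andP[s1 s2].
have {}H1 := H1 n u v uv dis s1; have {}H2 := H2 n u v uv dis s2.
apply: (@le_lt_trans _ _ (\sum_(i < n) (K * `|f (v i) - f (u i)| + L * `|g (v i) - g (u i)|))).
  by apply: ler_sum => i _; have [h1 [h2 h3]] := uv i; exact: H.
rewrite big_split /= -!mulr_sumr; move: H1 H2.
rewrite !ltr_pdivlMr ?ltr_wpDl //; set S := \sum_(i < n) _; set T := \sum_(i < n) _.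
have : 0 <= S by apply: sumr_ge0.
have : 0 <= T by apply: sumr_ge0.
by nra.
Qed.

Lemma abs_cont_sub a b f g : abs_cont_on a b f -> abs_cont_on a b g ->
  abs_cont_on a b (fun x => f x - g x).
Proof.
move=> fac gac; apply: (abs_cont_dominated ler01 ler01 fac gac) => x y _ _ _.
rewrite !mul1r (_ : _ - _ - _ = (f y - f x) - (g y - g x)); last by ring.
exact: ler_normB.
Qed.

Lemma abs_cont_mul a b f g : a <= b -> abs_cont_on a b f -> abs_cont_on a b g ->
  abs_cont_on a b (fun x => f x * g x).
Proof.
move=> ab fac gac.
have [B B0 fB] := abs_cont_bounded ab fac; have [C C0 gC] := abs_cont_bounded ab gac.
apply: (abs_cont_dominated (ltW C0) (ltW B0) fac gac) => x y ax xy yb.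
rewrite (_ : _ - _ = (f y - f x) * g x + f y * (g y - g x)); last by ring.
apply: (le_trans (ler_normD _ _)); rewrite !normrM mulrC; apply: lerD; apply: ler_wpM2r => //.
  by apply: gC; rewrite ax (le_trans xy).
by apply: fB; rewrite yb (le_trans ax).
Qed.

Lemma abs_cont_C1 a b f g : a <= b -> continuous g ->
  (forall x, a <= x <= b -> is_derive x 1 f (g x)) -> abs_cont_on a b f.
Proof.
move=> ab cg df.
have [m mab M] := EVT_max ab (continuous_subspaceT (cont_norm cg)).
apply: (@abs_cont_lipschitz _ _ _ `|g m|) => x y ax.
rewrite le_eqVlt => /predU1P[->|xy] yb; first by rewrite !subrr normr0 mulr0.
have [|c /andP[xc cy] ->] := @mvt _ f g x y xy.
  by move=> z /andP[xz zy]; apply: df; rewrite (le_trans ax) // (le_trans zy).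
rewrite normrM (@ger0_norm _ (y - x)) ?subr_ge0 ?(ltW xy) //.
rewrite ler_wpM2r ?subr_ge0 ?(ltW xy) //; apply: M.
by rewrite in_itv /= (le_trans ax (ltW xc)) (le_trans (ltW cy)).
Qed.

(* Real induction: [P] holds at [b] when at every point it passes from left to right. *)
Lemma real_induction (P : R -> Prop) a b : a <= b -> P a ->
  (forall x, a <= x <= b -> exists2 d, 0 < d & forall y z, a <= y -> y <= x -> x <= z ->
     z <= b -> x - y < d -> z - x < d -> P y -> P z) -> P b.
Proof.
move=> ab Pa step; pose S := [set x | a <= x <= b /\ P x].
have Sa : S a by split; rewrite ?lexx.
have ubS : has_ubound S by exists b => x [/andP[]].
have hsS : has_sup S by split => //; exists a.
have as_ : a <= sup S by exact: ub_le_sup.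
have sb : sup S <= b by apply: ge_sup; [exists a|move=> x [/andP[]]].
have [|d d0 H] := step (sup S); first by rewrite as_.
have [y [/andP[ay yb] Py] sy] := sup_adherent d0 hsS.
have ys : y <= sup S by apply: ub_le_sup => //; split => //; rewrite ay.
have hy : sup S - y < d by lra.
move: sb; rewrite le_eqVlt => /predU1P[e|sltb].
  by apply: (H y) => //; rewrite e ?subrr // -e.
pose z := sup S + Num.min (d / 2) (b - sup S).
have m0 : 0 < Num.min (d / 2) (b - sup S) by rewrite lt_min divr_gt0 //= subr_gt0.
have md : Num.min (d / 2) (b - sup S) < d by rewrite gt_min; apply/orP; left; lra.
have mb : Num.min (d / 2) (b - sup S) <= b - sup S by rewrite ge_min lexx orbT.
have Pz : P z by apply: (H y) => //; rewrite /z; lra.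
have : z <= sup S by apply: ub_le_sup => //; split => //; rewrite /z; lra.
by rewrite /z; lra.
Qed.

(** Lists replace families over ['I_n] because the real induction below extends them by [rcons]. *)
Lemma abs_cont_seq a b f e d (s : seq (R * R)) :
  (forall (n : nat) (u v : 'I_n -> R),
      (forall i, a <= u i /\ u i <= v i /\ v i <= b) ->
      (forall i j, i != j -> v i <= u j \/ v j <= u i) ->
      \sum_(i < n) (v i - u i) < d ->
      \sum_(i < n) `|f (v i) - f (u i)| < e) ->
  pairwise (fun p q : R * R => p.2 <= q.1) s ->
  all (fun p : R * R => [&& a <= p.1, p.1 <= p.2 & p.2 <= b]) s ->
  \sum_(p <- s) (p.2 - p.1) < d -> \sum_(p <- s) `|f p.2 - f p.1| < e.
Proof.
move=> H ps /(all_nthP (a, a)) As; rewrite !(big_nth (a, a)) !big_mkord.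
apply: H => [i|i j ij]; first by have /and3P[] := As i (ltn_ord i).
have /(pairwiseP (a, a)) P := ps.
have [ltij|ltji|e0] := ltngtP i j; last by rewrite (ord_inj e0) eqxx in ij.
  by left; apply: P; rewrite ?inE.
by right; apply: P; rewrite ?inE.
Qed.

Lemma lebesgue_measureU (A B : set R) : measurable A -> measurable B ->
  A `&` B = set0 -> (mu (A `|` B) = mu A + mu B)%E.
Proof. by move=> mA mB AB; apply: measureU. Qed.

Lemma lebesgue_measure_oc a b : a <= b -> mu `]a, b]%classic = (b - a)%:E.
Proof.
move=> ab; rewrite lebesgue_measure_itv /= lte_fin; case: ltP => [_|ba].
  by rewrite -EFinB.
by rewrite (_ : b = a) ?subrr //; apply/eqP; rewrite eq_le ab ba.
Qed.

Lemma null_cover (A : set R) (d : R) : mu.-negligible A -> 0 < d ->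
  exists U : set R, [/\ open U, A `<=` U & (mu U < d%:E)%E].
Proof.
move=> [B [mB B0 AB]] d0.
have Boo : (mu B < +oo)%E by rewrite B0.
have [U [oU BU UB]] := lebesgue_regularity_outer mB Boo d0.
exists U; split => //; first exact: subset_trans BU.
have mU : measurable U by exact: measurable_realfun.open_measurable.
rewrite -(setDUK BU) lebesgue_measureU ?setDIK ?B0 ?add0e //.
exact: measurableD.
Qed.

(** Real induction takes the place of a covering theorem. Inside a small open set [U] around the
    exceptional points a step is recorded as an interval, with total length below [d]; elsewhere the
    zero derivative bounds the increment by [e] times the step. *)
Theorem abs_cont_ae_derive0 a b f : a <= b -> abs_cont_on a b f ->
  {ae mu, forall x, a < x < b -> is_derive x 1 f 0} -> f b = f a.
Proof.
move=> ab fac fae.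
suff H e : 0 < e -> `|f b - f a| <= e * (b - a) + e.
  apply/eqP; rewrite -subr_eq0 -normr_le0 leNgt; apply/negP => pos.
  have c0 : 0 < b - a + 1 by lra.
  have := H (`|f b - f a| / 2 / (b - a + 1)); rewrite !divr_gt0 // => /(_ isT).
  rewrite -[X in _ <= _ + X]mulr1 -mulrDr mulrVK ?unitfE ?gt_eqF //; lra.
move=> e0; have [d d0 Hd] := fac e e0.
(* The endpoints join the null set because the hypothesis gives a derivative only inside []a,
   b[]. *)
pose A := (~` [set x | a < x < b -> is_derive x 1 f 0] `|` [set a]) `|` [set b].
have An : mu.-negligible A.
  have N1 (c : R) : mu.-negligible [set c].
    by exists [set c]; split => //; exact: lebesgue_measure_set1.
  by apply: negligibleU => //; exact: negligibleU.
have [U [oU AU Ud]] := null_cover An d0.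
have mU : measurable U by exact: measurable_realfun.open_measurable.
pose P x := exists s : seq (R * R), [/\ pairwise (fun p q : R * R => p.2 <= q.1) s,
  all (fun p : R * R => [&& a <= p.1, p.1 <= p.2 & p.2 <= x]) s,
  ((\sum_(p <- s) (p.2 - p.1))%:E <= mu (U `&` `[a, x]%classic))%E &
  `|f x - f a| <= e * (x - a) + \sum_(p <- s) `|f p.2 - f p.1|].
have [s [ps As sU fs]] : P b.
  apply: (real_induction ab).
    exists [::]; rewrite !big_nil /= !subrr normr0 mulr0 addr0; split => //.
  move=> x xab; have [xU|xU] := pselect (U x).
    have /nbhs_ballP[r /= r0 rU] : nbhs x U by exact: open_nbhs_nbhs.
    exists r => // y z ay yx xz zb xyr zxr [s [ps As sU fs]].
    exists (rcons s (y, z)); rewrite -!cats1 !big_cat !big_seq1 /=.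
    have yz : y <= z by exact: le_trans xz.
    split.
    - rewrite pairwise_cat ps /= andbT allrel1r.
      by apply: sub_all As => p /and3P[_ _].
    - rewrite all_cat /= lexx ay yz !andbT /=.
      by apply: sub_all As => p /and3P[-> -> h]; exact: le_trans yz.
    - rewrite EFinD (_ : U `&` `[a, z]%classic = (U `&` `[a, y]%classic) `|` `]y, z]%classic).
        rewrite lebesgue_measureU //.
        + by apply: leeD => //; rewrite lebesgue_measure_oc.
        + exact: measurableI.
        + apply/seteqP; split => // t /= [[_]]; rewrite !in_itv /=; lra.
      apply/seteqP; split => t /=.
        rewrite !in_itv /= => -[Ut /andP[at_ tz]]; have [ty|yt] := leP t y.
          by left; rewrite at_.
        by right.
      rewrite !in_itv /= => -[[Ut /andP[at_ ty]]|/andP[yt tz]].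
        by split => //; rewrite at_ (le_trans ty).
      split; last by rewrite (le_trans ay (ltW yt)).
      apply: rU; rewrite /ball /= ltr_norml; lra.
    - rewrite (_ : f z - f a = (f z - f y) + (f y - f a)); last by ring.
      apply: (le_trans (ler_normD _ _)); move: fs.
      have h : e * (y - a) <= e * (z - a) by rewrite ler_pM2l // lerD2r.
      by lra.
  have dx : is_derive x 1 f 0.
    have [h|h] := pselect (a < x < b -> is_derive x 1 f 0); last first.
      by exfalso; apply: xU; apply: AU; left; left.
    apply: h; rewrite !lt_neqAle; move: xab => /andP[-> ->]; rewrite !andbT.
    apply/andP; split; apply/eqP => ex; apply: xU; apply: AU.
      by left; right; rewrite /= ex.
    by right; rewrite /= ex.
  have [r r0 H] := derive_near dx e0.
  exists r => // y z ay yx xz zb xyr zxr [s [ps As sU fs]].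
  have yz : y <= z by exact: le_trans xz.
  exists s; split => //.
  - by apply: sub_all As => p /and3P[-> -> h]; exact: le_trans yz.
  - apply: (le_trans sU); apply: le_measure; rewrite ?inE; try exact: measurableI.
    by apply: setIS => t /=; rewrite !in_itv /= => /andP[-> h]; exact: le_trans yz.
  have := H y; rewrite distrC ger0_norm ?subr_ge0 // => /(_ xyr).
  have := H z; rewrite ger0_norm ?subr_ge0 // => /(_ zxr).
  rewrite !mul0r !subr0 => h1 h2.
  rewrite (_ : f z - f a = (f z - f x) - (f y - f x) + (f y - f a)); last by ring.
  apply: (le_trans (ler_normD _ _)).
  have := ler_normB (f z - f x) (f y - f x); lra.
apply: (le_trans fs); rewrite lerD2l; apply/ltW.
apply: (abs_cont_seq Hd) => //.
rewrite -lte_fin; apply: (le_lt_trans sU); apply: le_lt_trans Ud.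
by apply: le_measure; rewrite ?inE //; exact: measurableI.
Qed.

End AbsoluteContinuity.

(** * The primitive of an integrable potential *)

Section IntegrablePotential.
Context {R : realType}.
Notation mu := (@lebesgue_measure R).
Variable q : R -> R.
Hypothesis hq : mu.-integrable `[(0:R), +oo[ (fun x => (q x)%:E).

(** The extension by zero lets integrals run over []-oo, x]], so that primitives are continuous on
    the whole line, as the angle equation demands. *)
Definition potential : R -> R := q \_ `[(0:R), +oo[.

Lemma potentialE x : 0 <= x -> potential x = q x.
Proof. by move=> x0; rewrite /potential patchE mem_set //= in_itv /= x0. Qed.

Lemma potential_integrable : mu.-integrable setT (EFin \o potential).
Proof.
have [H _] := @integrable_mkcond _ _ _ mu `[(0:R), +oo[%classic (EFin \o q) (measurable_itv _).
by rewrite /potential -restrict_EFin; exact: H.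
Qed.

Lemma potential_integrableS (D : set R) : measurable D ->
  mu.-integrable D (EFin \o potential).
Proof. by move=> mD; apply: integrableS potential_integrable. Qed.

Lemma potential_normS (D : set R) : measurable D ->
  mu.-integrable D (EFin \o (fun x => `|potential x|)).
Proof. by move=> mD; apply: integrable_norm; exact: potential_integrableS. Qed.

Lemma potential_norm_EFin (D : set R) : measurable D ->
  (\int[mu]_(t in D) `|potential t|)%:E = (\int[mu]_(t in D) `|potential t|%:E)%E.
Proof.
by move=> mD; rewrite /Rintegral fineK //; exact: integrable_fin_num (potential_normS mD).
Qed.

(** This is the majorant [G] of the averaging argument. *)
Definition potential_var x : R := \int[mu]_(t in `]-oo, x]) `|potential t|.

Definition potential_mass : R := \int[mu]_t `|potential t|.

(** The constant makes it minus the integral over []x, +oo[], hence small at infinity, as the trap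
    requires. *)
Definition potential_primitive x : R :=
  \int[mu]_(t in `]-oo, x]) potential t - \int[mu]_t potential t.

Lemma potential_var_sub x y : x <= y ->
  potential_var y - potential_var x = \int[mu]_(t in `]x, y]) `|potential t|.
Proof.
move=> xy; apply: (Rintegral_itvB (a := -oo%O) (b := BRight y)) => //.
exact: potential_normS.
Qed.

Lemma potential_primitive_sub x y : x <= y ->
  potential_primitive y - potential_primitive x = \int[mu]_(t in `]x, y]) potential t.
Proof.
move=> xy; rewrite /potential_primitive opprB addrA subrK.
apply: (Rintegral_itvB (a := -oo%O) (b := BRight y)) => //.
exact: potential_integrableS.
Qed.

Lemma potential_primitive_var x y : x <= y ->
  `|potential_primitive y - potential_primitive x| <= potential_var y - potential_var x.
Proof.
move=> xy; rewrite potential_primitive_sub // potential_var_sub //.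
by apply: le_normr_Rintegral => //; exact: potential_integrableS.
Qed.

Lemma potential_var_mono x y : x <= y -> potential_var x <= potential_var y.
Proof. by move=> xy; rewrite -subr_ge0 potential_var_sub // Rintegral_ge0. Qed.

Lemma potential_massB x :
  potential_mass - potential_var x = \int[mu]_(t in `]x, +oo[) `|potential t|.
Proof.
rewrite /potential_mass -set_itvNyy.
by apply: (Rintegral_itvB (a := -oo%O) (b := +oo%O)) => //; exact: potential_normS.
Qed.

Lemma potential_var_bound x : 0 <= potential_var x <= potential_mass.
Proof.
by rewrite Rintegral_ge0 //= -subr_ge0 potential_massB Rintegral_ge0.
Qed.

Lemma potential_primitive_tail x :
  `|potential_primitive x| <= potential_mass - potential_var x.
Proof.
rewrite potential_massB /potential_primitive distrC -set_itvNyy.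
rewrite (Rintegral_itvB (a := -oo%O) (b := +oo%O)) //; last exact: potential_integrableS.
by apply: le_normr_Rintegral => //; exact: potential_integrableS.
Qed.

Lemma potential_primitive_bound x : `|potential_primitive x| <= potential_mass.
Proof.
apply: (le_trans (potential_primitive_tail x)).
by have /andP[h _] := potential_var_bound x; rewrite lerBlDr lerDl.
Qed.

Lemma potential_primitive_small e : 0 < e ->
  exists X, forall x, X <= x -> `|potential_primitive x| <= e.
Proof.
move=> e0; pose F (n : nat) : set R := `]-oo, n%:R]%classic.
have H : (\int[mu]_(x in F i) `|potential x|%:E @[i --> \oo] -->
          \int[mu]_(x in \bigcup_i F i) `|potential x|%:E)%E.
  apply: ge0_nondecreasing_set_cvg_integral.
  - apply/nondecreasing_seqP => n; apply/subsetPset => x; rewrite /F /= !in_itv /=.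
    by move=> /le_trans; apply; rewrite ler_nat.
  - by move=> n; exact: measurable_itv.
  - by move=> n; have /integrableP[] := potential_normS (measurable_itv `]-oo, n%:R]).
  - by move=> n x _; rewrite lee_fin.
have UF : \bigcup_i F i = setT.
  apply/seteqP; split => // x _; exists (Num.bound `|x|) => //.
  rewrite /F /= in_itv /=; apply: (le_trans (ler_norm _)); apply: ltW.
  by apply: archi_boundP.
rewrite UF in H.
have {}H : potential_var i%:R @[i --> \oo] --> potential_mass.
  apply: fine_cvg; rewrite /potential_mass /Rintegral fineK //.
  exact: integrable_fin_num (potential_normS measurableT).
move/cvgrPdist_le: H => /(_ e e0) [n _ Hn]; exists n%:R => x nx.
apply: (le_trans (potential_primitive_tail x)).
have := Hn n (leqnn n) => /= /ler_normlW; have := potential_var_mono nx; lra.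
Qed.

(** Absolute continuity of the integral, applied to the union of the []u i, v i]], which are
    disjoint even when they share endpoints. *)
Lemma potential_var_abs_cont a b : abs_cont_on a b potential_var.
Proof.
move=> e e0; have [d [d0 H]] := integral_normr_continuous potential_integrable e0.
exists d => // n u v uv dis s.
pose I (i : 'I_n) : set R := `]u i, v i]%classic.
have mI i : measurable (I i) by exact: measurable_itv.
have tI : trivIset setT I.
  apply/trivIsetP => i j _ _ ij; apply/seteqP; split => // t /= [].
  rewrite /I /= !in_itv /= => /andP[a1 a2] /andP[a3 a4].
  by have [h|h] := dis i j ij; lra.
pose D := \big[setU/set0]_(i < n) I i.
have mD : measurable D by exact: bigsetU_measurable.
have muD : mu D = (\sum_(i < n) (v i - u i))%:E.
  rewrite /D -sumEFin; transitivity (\sum_(i < n) mu (I i))%E.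
    by apply: measure_bigsetU_ord.
  by apply: eq_bigr => i _; rewrite /I lebesgue_measure_oc //; have [_ []] := uv i.
have Dd : (mu D < d%:E)%E by rewrite muD lte_fin.
have := H D mD Dd; congr (_ < _).
apply/EFin_inj; rewrite -sumEFin /Rintegral fineK; last first.
  exact: integrable_fin_num (potential_normS mD).
rewrite ge0_integral_bigsetU ?index_enum_uniq //.
- apply: eq_bigr => i _; have [_ [h _]] := uv i.
  rewrite potential_var_sub // ger0_norm; last by rewrite Rintegral_ge0.
  by rewrite potential_norm_EFin.
- exact: sub_trivIset tI.
- by have /integrableP[] := potential_normS mD.
Qed.

Lemma potential_primitive_abs_cont a b : abs_cont_on a b potential_primitive.
Proof.
have ac := @potential_var_abs_cont a b.
apply: (abs_cont_dominated ler01 ler01 ac ac) => x y _ xy _.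
apply: (le_trans (potential_primitive_var xy)); rewrite !mul1r.
have := ler_norm (potential_var y - potential_var x).
by have := normr_ge0 (potential_var y - potential_var x); lra.
Qed.

Lemma abs_cont_continuous (f : R -> R) : (forall a b, abs_cont_on a b f) -> continuous f.
Proof.
move=> fac x; apply/cvgrPdist_lt => e e0.
have [d d0 H] := abs_cont_dist (fac (x - 1) (x + 1)) e0.
have m0 : 0 < Num.min d 1 by rewrite lt_min d0 ltr01.
near=> y; have : `|x - y| < Num.min d 1 by near: y; exists (Num.min d 1).
rewrite lt_min => /andP[xyd]; rewrite ltr_norml => /andP[h1 h2].
by apply: H => //; lra.
Unshelve. all: by end_near. Qed.

Lemma potential_var_continuous : continuous potential_var.
Proof. by apply: abs_cont_continuous => a b; exact: potential_var_abs_cont. Qed.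

Lemma potential_primitive_continuous : continuous potential_primitive.
Proof. by apply: abs_cont_continuous => a b; exact: potential_primitive_abs_cont. Qed.

Lemma potential_primitive_derive :
  {ae mu, forall x : R, 0 < x -> is_derive x 1 potential_primitive (q x)}.
Proof.
have H := @FTC1Ny R potential.
have intN y : mu.-integrable `]-oo, y] (EFin \o potential) by exact: potential_integrableS.
have loc : locally_integrable [set: R] potential.
  by apply: open_integrable_locally; [exact: openT|exact: potential_integrable].
have := H intN loc; apply: filterS; first exact: (ae_filter_ringOfSetsType mu).
move=> x /= [D E] x0.
pose P y := \int[mu]_(t in `]-oo, y]) potential t.
have dP : is_derive x 1 P (q x).
  by apply: (deq (derivableP D)); rewrite -derive1E E potentialE // ltW.
by rewrite /potential_primitive; der; ring.
Qed.

End IntegrablePotential.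

(** * From angles back to solutions *)

Section PruferCoordinates.
Context {R : realType}.
Variables (Q : R -> R) (lam : R).
Hypothesis cQ : continuous Q.
Implicit Types (th : R -> R) (x : R).

(** The integrand is [r' / r], computed from [u' = u1 + Q u] and
    [u1' = (x - lam - Q^2) u - Q u1]. *)
Definition prufer_radius th : R -> R := fun x => expR (prim (fun y =>
  (1 + (y - lam) - Q y ^+ 2) * (sin (th y) * cos (th y)) +
  Q y * (sin (th y) ^+ 2 - cos (th y) ^+ 2)) x).

Definition prufer_u th : R -> R := fun x => prufer_radius th x * sin (th x).
Definition prufer_u1 th : R -> R := fun x => prufer_radius th x * cos (th x).
Definition prufer_du th : R -> R := fun x => prufer_u1 th x + Q x * prufer_u th x.

Lemma prufer_radius_gt0 th x : 0 < prufer_radius th x.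
Proof. exact: expR_gt0. Qed.

Lemma prufer_radius_derive th x : prufer_solution Q lam th ->
  is_derive x 1 (prufer_radius th) (((1 + (x - lam) - Q x ^+ 2) * (sin (th x) * cos (th x)) +
  Q x * (sin (th x) ^+ 2 - cos (th x) ^+ 2)) * prufer_radius th x).
Proof.
move=> sth; have cth : continuous th by exact: derive_cont sth.
have cS := cont_sin cth; have cC := cont_cos cth.
set rho := fun y => (1 + (y - lam) - Q y ^+ 2) * (sin (th y) * cos (th y)) +
  Q y * (sin (th y) ^+ 2 - cos (th y) ^+ 2).
have crho : continuous rho.
  rewrite /rho; under [Z in continuous Z]eq_fun do rewrite !expr2.
  apply: contD.
    apply: contM; last exact: contM.
    apply: contD; last by apply: contN; exact: contM.
    apply: contD; first exact: cont_cst.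
    by apply: contD; [move=> y; exact: cvg_id|exact: cont_cst].
  by apply: contM => //; apply: contD; [|apply: contN]; exact: contM.
have d1 := prim_derive crho x; rewrite {1}/prufer_radius -/rho.
by der; rewrite /prufer_radius -/rho -/(rho x) mulrC.
Qed.

Lemma prufer_u_derive th x : prufer_solution Q lam th ->
  is_derive x 1 (prufer_u th) (prufer_du th x).
Proof.
move=> sth; have d1 := prufer_radius_derive x sth; have d2 := sth x.
rewrite /prufer_u; der; rewrite /prufer_du /prufer_u1 /prufer_u /prufer.
have cs1 := cos2Dsin2 (th x).
move: (prufer_radius th x) (sin (th x)) (cos (th x)) (Q x) cs1 => r S C z cs1.
apply/eqP; rewrite -subr_eq0; apply/eqP.
rewrite (_ : _ - _ = r * (C + z * S) * (C ^+ 2 + S ^+ 2 - 1)); last by ring.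
by rewrite cs1 subrr mulr0.
Qed.

Lemma prufer_u1_derive th x : prufer_solution Q lam th ->
  is_derive x 1 (prufer_u1 th) ((x - lam - Q x ^+ 2) * prufer_u th x - Q x * prufer_u1 th x).
Proof.
move=> sth; have d1 := prufer_radius_derive x sth; have d2 := sth x.
rewrite {1}/prufer_u1; der; rewrite /prufer_u1 /prufer_u /prufer.
have cs1 := cos2Dsin2 (th x).
move: (prufer_radius th x) (sin (th x)) (cos (th x)) (Q x) cs1 => r S C z cs1.
apply/eqP; rewrite -subr_eq0; apply/eqP.
rewrite (_ : _ - _ = r * (C ^+ 2 + S ^+ 2 - 1) *
  ((x - lam - z ^+ 2) * S - z * C)); last by ring.
by rewrite cs1 subrr mulr0 mul0r.
Qed.

Lemma prufer_u_cont th : prufer_solution Q lam th -> continuous (prufer_u th).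
Proof. by move=> sth; apply: derive_cont => x; exact: prufer_u_derive. Qed.

Lemma prufer_u1_cont th : prufer_solution Q lam th -> continuous (prufer_u1 th).
Proof. by move=> sth; apply: derive_cont => x; exact: prufer_u1_derive. Qed.

Lemma prufer_du_cont th : prufer_solution Q lam th -> continuous (prufer_du th).
Proof.
move=> sth; apply: contD; first exact: prufer_u1_cont.
by apply: contM => //; exact: prufer_u_cont.
Qed.

Lemma prufer_u_abs_cont th b : 0 <= b -> prufer_solution Q lam th ->
  abs_cont_on 0 b (prufer_u th).
Proof.
move=> b0 sth; apply: (abs_cont_C1 b0 (prufer_du_cont sth)) => x _.
exact: prufer_u_derive.
Qed.

Lemma prufer_du_abs_cont th b : 0 <= b -> abs_cont_on 0 b Q -> prufer_solution Q lam th ->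
  abs_cont_on 0 b (prufer_du th).
Proof.
move=> b0 Qac sth.
have u1ac : abs_cont_on 0 b (prufer_u1 th).
  apply: (abs_cont_C1 b0 _ (fun x _ => prufer_u1_derive x sth)).
  apply: contD; last by apply: contN; apply: contM => //; exact: prufer_u1_cont.
  apply: contM; last exact: prufer_u_cont.
  apply: contD; first by apply: contD; [move=> y; exact: cvg_id|exact: cont_cst].
  by under [Z in continuous Z]eq_fun do rewrite expr2; apply: contN; exact: contM.
have Quac := abs_cont_mul b0 Qac (prufer_u_abs_cont b0 sth).
apply: (abs_cont_dominated ler01 ler01 u1ac Quac) => x y _ _ _.
rewrite !mul1r /prufer_du; apply: le_trans (ler_normD _ _).
by rewrite le_eqVlt; apply/orP; left; apply/eqP; congr (`| _ |); ring.
Qed.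

Lemma prufer_du_derive th x q : prufer_solution Q lam th -> is_derive x 1 Q q ->
  is_derive x 1 (prufer_du th) ((x + q - lam) * prufer_u th x).
Proof.
move=> sth dQ; have d1 := prufer_u_derive x sth; have d2 := prufer_u1_derive x sth.
by rewrite {1}/prufer_du; der; rewrite /prufer_du; ring.
Qed.

Definition wronskian th ph x : R :=
  prufer_du th x * prufer_u ph x - prufer_u th x * prufer_du ph x.

(** Rewritten with [u1] the terms in [Q] cancel, so the Wronskian is differentiable everywhere
    although [u'] need not be. *)
Lemma wronskian_cst th ph x : prufer_solution Q lam th -> prufer_solution Q lam ph ->
  wronskian th ph x = wronskian th ph 0.
Proof.
move=> sth sph.
pose w y := prufer_u1 th y * prufer_u ph y - prufer_u th y * prufer_u1 ph y.
have wE y : wronskian th ph y = w y by rewrite /wronskian /prufer_du /w; ring.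
rewrite !wE; have D (y : R) : is_derive y 1 w 0.
  have d1 := prufer_u_derive y sth; have d2 := prufer_u1_derive y sth.
  have d3 := prufer_u_derive y sph; have d4 := prufer_u1_derive y sph.
  by rewrite /w; der; rewrite /prufer_du; ring.
exact: is_derive_0_is_cst.
Qed.

End PruferCoordinates.

(** * Eigenvalues as the points where the phase is a multiple of pi *)

Section Eigenvalues.
Context {R : realType}.
Notation mu := (@lebesgue_measure R).
Variables (q : R -> R) (X0 : R).
Hypothesis hq : mu.-integrable `[(0:R), +oo[ (fun x => (q x)%:E).
Let Q := potential_primitive q.
Hypothesis X01 : 1 <= X0.
Hypothesis Q4 : forall x, X0 <= x -> `|Q x| <= 1 / 4.
Implicit Types (lam x : R).

Let cQ : continuous Q. Proof. exact: potential_primitive_continuous. Qed.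
Let QM x : `|Q x| <= potential_mass q. Proof. exact: potential_primitive_bound. Qed.

(* In the trap [|u| <= |u1|] with opposite signs, so [u^2] decays at least like
   [exp (- 3 x / 2)]. *)
Lemma trapped_decay lam th x : trapped Q X0 lam th -> trap_start X0 lam <= x ->
  [/\ prufer_u Q lam th x != 0 &
   2 * prufer_u Q lam th x * prufer_du Q lam th x <= - (3 / 2) * prufer_u Q lam th x ^+ 2].
Proof.
move=> tth sx; have [s0 c1 _] := cotangent_trapped tth sx.
have r0 := prufer_radius_gt0 Q lam th x.
have X0x : X0 <= x by have [h _] := trap_start_ge X0 lam; exact: le_trans sx.
split; first by apply: mulf_neq0; [rewrite gt_eqF|rewrite lt_eqF].
rewrite /prufer_du /prufer_u1 /prufer_u.
have cs : - sin (th x) <= cos (th x).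
  by move: c1; rewrite /cotangent ler_ndivrMr // mulN1r.
have := Q4 X0x; rewrite ler_norml => /andP[_ q4].
move: (prufer_radius Q lam th x) (sin (th x)) (cos (th x)) (Q x) r0 s0 cs q4.
move=> r S C z r0 s0 cs q4.
rewrite (_ : _ * _ = 2 * r ^+ 2 * (S * C + z * S ^+ 2)); last by ring.
rewrite (_ : _ * (r * S) ^+ 2 = 2 * r ^+ 2 * (- (3 / 4) * S ^+ 2)); last by field.
rewrite ler_pM2l ?mulr_gt0 ?exprn_gt0 //.
have : S * C <= S * - S by rewrite ler_nM2l.
have : z * S ^+ 2 <= 1 / 4 * S ^+ 2 by rewrite ler_wpM2r // sqr_ge0.
rewrite !expr2; lra.
Qed.

(** By [trapped_decay], [P + 2/3 u^2] is nonincreasing past [X]; 2/3 is the inverse of the decay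
    rate 3/2. *)
Lemma trapped_square_bounded lam th (P : R -> R) : trapped Q X0 lam th ->
  (forall x, is_derive x 1 P (prufer_u Q lam th x ^+ 2)) ->
  exists B, forall x, P x <= B.
Proof.
move=> tth dP; set u := prufer_u Q lam th in dP *; set X := trap_start X0 lam.
exists (P X + 2 / 3 * u X ^+ 2) => x; have [Xx|/ltW xX] := leP X x; last first.
  apply: (@le_trans _ _ (P X)); last by rewrite lerDl mulr_ge0 // sqr_ge0.
  by apply: (derive_ge0_le xX (fun y _ => dP y)) => y _; exact: sqr_ge0.
have H y : X <= y <= x -> is_derive y 1 (fun y => - P y - 2 / 3 * u y ^+ 2)
    (- u y ^+ 2 - 2 / 3 * (2 * u y * prufer_du Q lam th y)).
  move=> _; have d1 := dP y; have d2 := prufer_u_derive cQ y tth.1.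
  by rewrite -/u in d2; der; ring.
have := derive_ge0_le Xx H; have := sqr_ge0 (u x) => h0 h.
suff : - P X - 2 / 3 * u X ^+ 2 <= - P x - 2 / 3 * u x ^+ 2 by lra.
apply: h => y /andP[Xy _]; have [_] := trapped_decay tth (ltW Xy); rewrite -/u; lra.
Qed.

(** A primitive of [u^2] is nondecreasing, so a bound gives it a limit at infinity, and the improper
    fundamental theorem makes the integral finite. *)
Lemma square_integrable (u : R -> R) : continuous u ->
  (forall P : R -> R, (forall x, is_derive x 1 P (u x ^+ 2)) -> exists B, forall x, P x <= B) ->
  L2_half u.
Proof.
move=> cu bd.
have cu2 : continuous (fun x => u x ^+ 2).
  by under [Z in continuous Z]eq_fun do rewrite expr2; exact: contM.
split.
  exact: measurable_funTS (measurable_realfun.continuous_measurable_fun cu).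
have dP := prim_derive cu2; have [B PB] := bd _ dP.
have mono : {homo prim (fun x => u x ^+ 2) : x y / x <= y}.
  move=> x y xy; apply: (derive_ge0_le xy (fun z _ => dP z)) => z _; exact: sqr_ge0.
have cvgP : prim (fun x => u x ^+ 2) x @[x --> +oo] --> sup (range (prim (fun x => u x ^+ 2))).
  by apply: nondecreasing_cvgr => //; exists B => _ [x _ <-].
apply/integrableP; split.
  apply/measurable_realfun.measurable_EFinP.
  exact: measurable_funTS (measurable_realfun.continuous_measurable_fun cu2).
under eq_integral do rewrite gee0_abs ?lee_fin ?sqr_ge0 //.
rewrite (@ge0_continuous_FTC2y R _ (prim (fun x => u x ^+ 2)) 0 _ _ _ cvgP).
- by rewrite -EFinB ltry.
- by move=> x _; exact: sqr_ge0.
- exact: continuous_subspaceT.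
- by move=> x _; apply: ex_derive.
- by apply: cvg_at_right_filter; exact: (derive_continuous (dP 0)).
- by move=> x _; rewrite derive1E; have [_ ->] := dP x.
Qed.

Lemma L2_half_scale (a : R) (u : R -> R) : L2_half u -> L2_half (fun x => a * u x).
Proof.
move=> [m1 i1]; split; first exact: measurable_realfun.measurable_funM.
have := @integrableZl _ _ _ mu `[(0:R), +oo[%classic (measurable_itv _) (a ^+ 2) _ i1.
rewrite (_ : (fun x => ((a ^+ 2)%:E * (u x ^+ 2)%:E)%E) =
  (fun x => ((a * u x) ^+ 2)%:E)) //.
by apply/funext => x; rewrite -[LHS]/((a ^+ 2 * u x ^+ 2)%:E) exprMn.
Qed.

Let is_eigenfunction lam phi psi chi :=
  loc_abs_cont0 phi /\ loc_abs_cont0 psi /\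
  {ae mu, forall x : R, 0 < x -> is_derive x (1:R) phi (psi x)} /\
  {ae mu, forall x : R, 0 < x -> is_derive x (1:R) psi (chi x)} /\
  L2_half phi /\
  L2_half (fun x => - chi x + (x + q x) * phi x) /\
  {ae mu, forall x : R, 0 < x -> - chi x + (x + q x) * phi x = lam * phi x} /\
  phi 0 = 0 /\
  ~ {ae mu, forall x : R, 0 <= x -> phi x = 0}.

(** The decaying solution is the eigenfunction. Taking [chi] to be [(x + q x - lam) u] at every
    point turns the equation into an identity, and its left side into [lam u], which is square
    integrable with [u]. *)
Lemma sin0_eigenvalue lam : sin (decaying_angle Q X0 lam 0) = 0 ->
  dirichlet_eigenvalue q lam.
Proof.
move=> s0; have tth := decaying_angleP cQ QM Q4 lam.
set th := decaying_angle Q X0 lam in s0 tth; have sth := tth.1.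
set u := prufer_u Q lam th; set du := prufer_du Q lam th.
have uL2 : L2_half u.
  apply: square_integrable; first exact: prufer_u_cont.
  by move=> P dP; exact: trapped_square_bounded tth dP.
exists u, du, (fun x => (x + q x - lam) * u x); split.
  by move=> b b0; apply: prufer_u_abs_cont => //; exact: ltW.
split.
  move=> b b0; apply: prufer_du_abs_cont => //; first exact: ltW.
  exact: potential_primitive_abs_cont.
split; first by apply: aeW => x _; exact: prufer_u_derive.
split.
  have := potential_primitive_derive hq.
  apply: filterS; first exact: (ae_filter_ringOfSetsType mu).
  by move=> x /= H x0; exact: prufer_du_derive (H x0).
split=> //; split.
  rewrite (_ : (fun x => _) = (fun x => lam * u x)); last by apply/funext => x; ring.
  exact: L2_half_scale.
split; first by apply: aeW => x _; ring.
split; first by rewrite /u /prufer_u s0 mulr0.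
(* [u] has no zero past [X], so the null set would contain an interval of length 1. *)
move=> [A [mA A0 sub]]; pose X := trap_start X0 lam.
have XA : `[X, X + 1]%classic `<=` A.
  move=> x /=; rewrite in_itv /= => /andP[Xx _]; apply: sub => /= H.
  have [/eqP h _] := trapped_decay tth Xx; apply: h; apply: H.
  by apply: le_trans Xx; have := trap_start_gt0 X01 lam; rewrite -/X; exact: ltW.
pose I : set R := `[X, X + 1]%classic.
have : (mu I <= mu A)%E by apply: le_measure; rewrite ?inE //; exact: measurable_itv.
rewrite A0 /I lebesgue_measure_itv /= lte_fin ltrDl ltr01 -EFinB lee_fin addrC addKr.
by rewrite ler10.
Qed.

(** An eigenfunction is arbitrary at negative arguments, whereas primitives on the line need
    continuity; hence the continuous stand-in [g]. *)
Lemma L2_prim_bounded (f g P : R -> R) : L2_half f -> continuous g ->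
  (forall x, 0 <= x -> f x = g x) -> (forall x, is_derive x 1 P (g x ^+ 2)) ->
  exists B, forall x, 0 <= x -> P x <= B.
Proof.
move=> [mf intf] cg fg dP.
have cg2 : continuous (fun x => g x ^+ 2).
  by under [Z in continuous Z]eq_fun do rewrite expr2; exact: contM.
exists (P 0 + fine (\int[mu]_(x in `[(0:R), +oo[) ((f x) ^+ 2)%:E)) => x x0.
move: x0; rewrite le_eqVlt => /predU1P[<-|x0].
  by rewrite lerDl fine_ge0 // integral_ge0 // => y _; rewrite lee_fin sqr_ge0.
have I : (\int[mu]_(t in `[0%R, x]) (g t ^+ 2)%:E = (P x)%:E - (P 0%R)%:E)%E.
  apply: continuous_FTC2 => //.
  - exact: continuous_subspaceT.
  - split.
    + by move=> y _; apply: ex_derive.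
    + by apply: cvg_at_right_filter; exact: (derive_continuous (dP 0)).
    + by apply: cvg_at_left_filter; exact: (derive_continuous (dP x)).
  - by move=> y _; rewrite derive1E; have [_ ->] := dP y.
rewrite -lerBlDl -lee_fin fineK; last exact: integrable_fin_num.
rewrite EFinB -I.
rewrite (@eq_integral _ _ _ mu _ (fun t => (f t ^+ 2)%:E)); last first.
  by move=> t; rewrite inE /= in_itv /= => /andP[t0 _]; rewrite fg.
apply: ge0_subset_integral => //.
- by have /integrableP[] := intf.
- by move=> t _; rewrite lee_fin sqr_ge0.
- by move=> t /=; rewrite !in_itv /= => /andP[-> _].
Qed.

(** A given eigenfunction solves its equation only almost everywhere, so constancy comes from
    [abs_cont_ae_derive0]. *)
Lemma eigenfunction_wronskian lam phi psi chi th x : is_eigenfunction lam phi psi chi ->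
  prufer_solution Q lam th -> 0 <= x ->
  psi x * prufer_u Q lam th x - phi x * prufer_du Q lam th x =
  psi 0 * prufer_u Q lam th 0 - phi 0 * prufer_du Q lam th 0.
Proof.
move=> [phiac [psiac [dphi [dpsi [_ [_ [ode _]]]]]]] sth.
rewrite le_eqVlt => /predU1P[<-//|x0].
apply: (@abs_cont_ae_derive0 _ 0 x (fun x => psi x * prufer_u Q lam th x -
  phi x * prufer_du Q lam th x) (ltW x0)).
  apply: abs_cont_sub; apply: abs_cont_mul; rewrite ?(ltW x0) //.
  - exact: psiac.
  - by apply: prufer_u_abs_cont => //; exact: ltW.
  - exact: phiac.
  - apply: prufer_du_abs_cont => //; first exact: ltW.
    exact: potential_primitive_abs_cont.
have dQ := potential_primitive_derive hq.
have Fae := ae_filter_ringOfSetsType mu; near=> y => /andP[y0 _].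
have d1 : is_derive y 1 phi (psi y) by move: y0; near: y.
have d2 : is_derive y 1 psi (chi y) by move: y0; near: y.
have e : - chi y + (y + q y) * phi y = lam * phi y by move: y0; near: y.
have dq : is_derive y 1 Q (q y) by move: y0; near: y.
have d3 := prufer_u_derive cQ y sth; have d4 := prufer_du_derive cQ sth dq.
der; rewrite (_ : chi y = (y + q y) * phi y - lam * phi y); last by rewrite -e; ring.
by ring.
Unshelve. all: by end_near. Qed.

(* With [J = phi / u], [c J' = (c / u)^2] and [(- 1 / (c J))' = 1 / phi^2]; since
   [phi^2 + 1 / phi^2 >= 2], a non zero Wronskian [c] prevents [phi] from being in L2. *)
Lemma wronskian_L2 lam (phi u : R -> R) (c X B : R) (P : R -> R) : c != 0 ->
  (forall x, X <= x -> u x != 0) ->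
  (forall x, X <= x -> is_derive x 1 (fun y => phi y / u y) (c / u x ^+ 2)) ->
  (forall x, X <= x -> u x ^+ 2 <= u X ^+ 2) ->
  (forall x, is_derive x 1 P (phi x ^+ 2)) ->
  (forall x, X <= x -> P x <= B) -> False.
Proof.
move=> c0 u0 dJ umono dP PB.
have c2 : 0 < c ^+ 2 by rewrite exprn_even_gt0.
have up x : X <= x -> 0 < u x ^+ 2 by move=> Xx; rewrite exprn_even_gt0 //= u0.
pose K x := c * (phi x / u x).
have dK x : X <= x -> is_derive x 1 K (c ^+ 2 / u x ^+ 2).
  move=> Xx; apply: (deq (dmul (dcst x c) (dJ x Xx))).
  by rewrite mul0r add0r mulrA expr2.
pose k := c ^+ 2 / u X ^+ 2.
have k0 : 0 < k by rewrite divr_gt0 // up.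
have Kgrow x : X <= x -> K X + k * (x - X) <= K x.
  move=> Xx.
  have H y : X <= y <= x -> is_derive y 1 (fun y => K y - k * (y - X)) (c ^+ 2 / u y ^+ 2 - k).
    by move=> /andP[Xy _]; have d := dK y Xy; der; ring.
  have := derive_ge0_le Xx H; rewrite subrr mulr0 subr0 => h.
  suff : K X <= K x - k * (x - X) by lra.
  apply: h => y /andP[Xy _]; rewrite subr_ge0 /k ler_wpM2l ?(ltW c2) //.
  by rewrite lef_pV2 ?posrE ?up ?umono // ltW.
(* [K] has slope at least [k] because [u^2] never exceeds its value at [X]. From [Y] on, [K >= 1],
   so [phi] has no zero there and [1 / K] stays in [[0, 1]]. *)
pose Y := X + `|1 - K X| / k.
have XY : X <= Y by rewrite lerDl divr_ge0 // ltW.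
have K1 x : Y <= x -> 1 <= K x.
  move=> Yx; have Xx : X <= x by exact: le_trans Yx.
  apply: le_trans (Kgrow x Xx).
  have : `|1 - K X| <= k * (x - X).
    by rewrite mulrC -ler_pdivrMr // lerBrDl.
  by have := ler_norm (1 - K X); lra.
have key x : Y <= x -> 2 * (x - Y) <= P x - (K x)^-1 - (P Y - (K Y)^-1).
  move=> Yx.
  have H y : Y <= y <= x -> is_derive y 1 (fun y => P y - (K y)^-1 - 2 * (y - Y))
      (phi y ^+ 2 + (phi y ^+ 2)^-1 - 2).
    move=> /andP[Yy _]; have Xy : X <= y by exact: le_trans Yy.
    have Kp : 0 < K y by apply: lt_le_trans (K1 y Yy).
    have Kn : K y != 0 by rewrite gt_eqF.
    have uy := u0 y Xy.
    have phin : phi y != 0.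
      by apply: contraNneq Kn => e; rewrite /K e mul0r mulr0.
    have d1 := dK y Xy; have d2 := dP y; der; rewrite /K; field.
    by rewrite uy c0 phin.
  have := derive_ge0_le Yx H; rewrite subrr mulr0 subr0 => h.
  suff : P Y - (K Y)^-1 <= P x - (K x)^-1 - 2 * (x - Y) by lra.
  apply: h => y /andP[Yy _]; have Xy : X <= y by rewrite (le_trans XY) // ltW.
  have Kp : 0 < K y by apply: lt_le_trans (K1 y (ltW Yy)).
  have phin : phi y != 0.
    by apply: contraTneq Kp => e; rewrite /K e mul0r mulr0 ltxx.
  have p0 : 0 < phi y ^+ 2 by rewrite exprn_even_gt0.
  rewrite (_ : _ - 2 = (phi y ^+ 2 - 1) ^+ 2 / phi y ^+ 2); last first.
    by field.
  by rewrite divr_ge0 ?sqr_ge0 // ltW.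
pose x := Y + `|B - P Y| + 1.
have Yx : Y <= x by rewrite /x -addrA lerDl addr_ge0.
have := key x Yx; have := PB x (le_trans XY Yx).
have : (K Y)^-1 <= 1 by rewrite invf_le1 ?K1 // (lt_le_trans _ (K1 Y _)).
have : 0 <= (K x)^-1 by rewrite invr_ge0 (le_trans _ (K1 x Yx)).
by rewrite /x; have := ler_norm (B - P Y); have := normr_ge0 (B - P Y); lra.
Qed.

(** The eigenfunction is [(e u - c v) / w] with [u] decaying and [v] a second solution. Square
    integrability forces [c = 0], so it is a nonzero multiple of [u], and its zero at 0 is a zero of
    [u]. *)
Lemma eigenvalue_sin0 lam : dirichlet_eigenvalue q lam ->
  sin (decaying_angle Q X0 lam 0) = 0.
Proof.
move=> [phi [psi [chi ef]]]; have tth := decaying_angleP cQ QM Q4 lam.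
set th := decaying_angle Q X0 lam in tth *; have sth := tth.1.
(* The shift by a right angle makes the Wronskian at 0 the product of the two radii, hence
   nonzero. *)
have [ph ph0 sph] := prufer_solution_exists lam 0 (th 0 + pi / 2) cQ.
set u := prufer_u Q lam th; set v := prufer_u Q lam ph.
pose w := wronskian Q lam th ph 0.
have w0 : w != 0.
  rewrite /w /wronskian /prufer_du /prufer_u /prufer_u1 ph0 sinDpihalf cosDpihalf.
  have r1 := prufer_radius_gt0 Q lam th 0; have r2 := prufer_radius_gt0 Q lam ph 0.
  have cs1 := cos2Dsin2 (th 0).
  rewrite (_ : _ - _ = prufer_radius Q lam th 0 * prufer_radius Q lam ph 0 *
    (cos (th 0) ^+ 2 + sin (th 0) ^+ 2)); last by ring.
  by rewrite cs1 mulr1 mulf_neq0 // gt_eqF.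
have wE x : prufer_du Q lam th x * v x - u x * prufer_du Q lam ph x = w.
  exact: wronskian_cst.
pose c := psi 0 * u 0 - phi 0 * prufer_du Q lam th 0.
pose e := psi 0 * v 0 - phi 0 * prufer_du Q lam ph 0.
pose phi_c x := (e * u x - c * v x) / w.
have phiE x : 0 <= x -> phi x = phi_c x.
  move=> x0; have h1 := eigenfunction_wronskian ef sth x0.
  have h2 := eigenfunction_wronskian ef sph x0.
  rewrite -/u -/c in h1; rewrite -/v -/e in h2.
  by rewrite /phi_c -h1 -h2 -(wE x); field; rewrite wE.
have [_ [_ [_ [_ [phiL2 [_ [_ [phi0 nz]]]]]]]] := ef.
have cu : continuous u by exact: prufer_u_cont.
have cv : continuous v by exact: prufer_u_cont.
have c_phi : continuous phi_c.
  apply: contM; last exact: cont_cst.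
  by apply: contD; [|apply: contN]; apply: contM => //; exact: cont_cst.
have c2 : continuous (fun x => phi_c x ^+ 2).
  by under [Z in continuous Z]eq_fun do rewrite expr2; exact: contM.
have [B PB] := L2_prim_bounded phiL2 c_phi phiE (prim_derive c2).
set X := trap_start X0 lam; have Xp : 0 < X by exact: trap_start_gt0.
have c0 : c = 0.
  apply/eqP; apply/negPn/negP => cn0.
  apply: (@wronskian_L2 lam phi_c u c X B (prim (fun x => phi_c x ^+ 2)) cn0).
  - by move=> x Xx; have [] := trapped_decay tth Xx.
  - move=> x Xx; have [un0 _] := trapped_decay tth Xx; rewrite -/u in un0.
    have d1 := prufer_u_derive cQ x sth; have d2 := prufer_u_derive cQ x sph.
    rewrite -/u -/v in d1 d2; rewrite {1}/phi_c; der.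
    rewrite -(wE x); field; by rewrite un0 wE.
  - move=> x Xx.
    have H y : X <= y <= x -> is_derive y 1 (fun y => - u y ^+ 2)
        (- (2 * u y * prufer_du Q lam th y)).
      by move=> _; have d1 := prufer_u_derive cQ y sth; rewrite -/u in d1; der; ring.
    have := derive_ge0_le Xx H; rewrite lerN2; apply.
    move=> y /andP[Xy _]; have [_] := trapped_decay tth (ltW Xy).
    by rewrite -/u; have := sqr_ge0 (u y); lra.
  - exact: prim_derive.
  - by move=> x Xx; apply: PB; rewrite (le_trans (ltW Xp)).
have e0 : e != 0.
  apply/eqP => e0; apply: nz; apply: aeW => x x0.
  by rewrite phiE // /phi_c c0 e0 !mul0r subrr mul0r.
have /eqP := phi0; rewrite phiE // /phi_c c0 mul0r subr0 !mulf_eq0 invr_eq0.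
rewrite (negbTE e0) (negbTE w0) orbF /= (gt_eqF (prufer_radius_gt0 _ _ _ _)) /=.
by move=> /eqP.
Qed.

Lemma eigenvalueP lam : dirichlet_eigenvalue q lam <->
  exists k : int, eigen_phase Q X0 lam = k%:~R * pi.
Proof.
split=> [/eigenvalue_sin0 /sin_eq0P [k e]|[k e]].
  by exists (- k); rewrite /eigen_phase e mulrNz mulNr.
apply: sin0_eigenvalue; rewrite -[decaying_angle _ _ _ _]opprK -/(eigen_phase Q X0 lam).
by rewrite e sinN sin_intpi oppr0.
Qed.

End Eigenvalues.

(** * Counting the levels of an increasing phase *)

Section PhaseCounting.
Context {R : realType}.
Variable F : R -> R.
Hypothesis Fcont : continuous F.
Hypothesis Flt : {homo F : x y / x < y}.
Hypothesis FNpi : forall mu, - pi < F mu.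
Hypothesis FT : forall v, exists mu, v <= F mu.

Lemma phase_ivt a v : F a <= v -> exists mu, F mu = v.
Proof.
move=> av; have [b vb] := FT v.
have [ab|ba] := leP a b; last first.
  by have := Flt ba; rewrite ltNge (le_trans av vb).
have [||c _ <-] := @IVT R F a b v ab; last by exists c.
- exact: continuous_subspaceT.
- by rewrite ge_min av /= le_max vb orbT.
Qed.

Lemma phase_inj : injective F.
Proof.
move=> x y Fxy; case: (ltgtP x y) => // /Flt; by rewrite Fxy ltxx.
Qed.

Lemma phase_level_nat mu (k : int) : F mu = k%:~R * pi -> exists n : nat, F mu = n%:R * pi.
Proof.
move=> Fk; have := FNpi mu; rewrite Fk -mulN1r ltr_pM2r ?pi_gt0//.
rewrite (_ : -1 = (-1)%:~R)// ltr_int => k1.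
have : (0 <= k)%R by rewrite -ltzD1 addrC -ltrBlDl add0r.
by case: k {k1} Fk => // n Fn _; exists n.
Qed.

(** The attained levels form an upward closed set of naturals, hence are [n0], [n0 + 1], ... with
    [n0] the least. *)
Lemma phase_levels_enum : exists lam : nat -> R,
  {homo lam : m n / (m < n)%N >-> m < n} /\
  (forall mu, (exists k : int, F mu = k%:~R * pi) <-> exists k, lam k = mu).
Proof.
pose S (n : nat) := `[< exists mu, F mu = n%:R * pi >].
have Sup m n : (m <= n)%N -> S m -> S n.
  move=> mn /asboolP[mu Fm]; apply/asboolP; apply: (@phase_ivt mu).
  by rewrite Fm ler_pM2r ?pi_gt0// ler_nat.
have exS : exists n, S n.
  exists (Num.bound `|F 0 / pi|); apply/asboolP; apply: (@phase_ivt 0).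
  rewrite -ler_pdivrMr ?pi_gt0//; apply: le_trans (ler_norm _) _.
  by rewrite ltW// archi_boundP.
have [n0 Sn0 n0min] := ex_minnP exS.
have hS k : exists mu, F mu = (n0 + k)%:R * pi.
  by apply/asboolP/(Sup n0) => //; exact: leq_addr.
pose lam k := projT1 (cid (hS k)).
have Flam k : F (lam k) = (n0 + k)%:R * pi by rewrite /lam; case: cid.
exists lam; split.
  move=> m n mn; rewrite ltNge; apply/negP; rewrite le_eqVlt => /orP[/eqP nm|/Flt].
    have := Flam m; rewrite -nm Flam => /(mulIf (lt0r_neq0 (pi_gt0 R)))/eqP.
    by rewrite eqr_nat eqn_add2l gtn_eqF.
  by rewrite !Flam ltr_pM2r ?pi_gt0// ltr_nat ltn_add2l ltnNge ltnW.
move=> mu; split=> [[k /phase_level_nat[n Fn]]|[k <-]]; last first.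
  by exists (n0 + k)%:Z; rewrite Flam.
have n0n : (n0 <= n)%N by apply/n0min/asboolP; exists mu.
by exists (n - n0)%N; apply: phase_inj; rewrite Flam subnKC.
Qed.

(** No level can be skipped: [n0 + k + 1] is attained at some [lam j] with [k < j], so [lam k.+1] is
    at most that point, while its level exceeds [n0 + k]. *)
Lemma phase_levels_consecutive (lam : nat -> R) :
  {homo lam : m n / (m < n)%N >-> m < n} ->
  (forall mu, (exists k : int, F mu = k%:~R * pi) <-> exists k, lam k = mu) ->
  exists n0 : nat, forall k, F (lam k) = (n0 + k)%:R * pi.
Proof.
move=> lamlt lamE.
have lev k : exists n : nat, F (lam k) = n%:R * pi.
  have [|j Fj] := (lamE (lam k)).2; first by exists k.
  exact: phase_level_nat Fj.
have [n0 Fn0] := lev 0%N; exists n0; elim=> [|k IH]; first by rewrite addn0.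
have [|mu Fmu] := @phase_ivt (lam k) ((n0 + k.+1)%:R * pi).
  by rewrite IH ler_pM2r ?pi_gt0// ler_nat leq_add2l.
have [|j lamj] := (lamE mu).1; first by exists (n0 + k.+1)%:Z; rewrite Fmu.
have kj : (k < j)%N.
  rewrite ltnNge leq_eqVlt; apply/negP => /orP[/eqP jk|/lamlt/Flt].
    have := Fmu; rewrite -lamj jk IH => /(mulIf (lt0r_neq0 (pi_gt0 R)))/eqP.
    by rewrite eqr_nat eqn_add2l ltn_eqF.
  by rewrite lamj IH Fmu ltr_pM2r ?pi_gt0// ltr_nat ltn_add2l ltnNge leqnSn.
have [p Fp] := lev k.+1.
have kp : (n0 + k < p)%N.
  by have /Flt := lamlt _ _ (ltnSn k); rewrite IH Fp ltr_pM2r ?pi_gt0// ltr_nat.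
have pk : (p <= n0 + k.+1)%N.
  have : F (lam k.+1) <= F mu.
    rewrite -lamj; move: kj; rewrite leq_eqVlt => /orP[/eqP->//|/lamlt/Flt].
    exact: ltW.
  by rewrite Fp Fmu ler_pM2r ?pi_gt0// ler_nat.
by rewrite Fp; congr (_%:R * _); apply/eqP; rewrite eqn_leq pk addnS.
Qed.

End PhaseCounting.

(** * Inverting the power three halves *)

Section PowerInversion.
Context {R : realType}.

(** The power lies between 1 and [t]. *)
Lemma powR_near1 (t r : R) : 0 < t -> 0 <= r <= 1 -> `|t `^ r - 1| <= `|t - 1|.
Proof.
move=> t0 /andP[r0 r1]; have [t1|t1] := leP 1 t.
  have h : 1 <= t `^ r by rewrite -(powRr0 t) ler_powR.
  by rewrite !ger0_norm ?subr_ge0// lerD2r ler1_powR.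
have t01 : 0 < t <= 1 by rewrite t0 ltW.
have h : t `^ r <= 1 by rewrite -(powRr0 t) ger_powR.
by rewrite !ler0_norm ?subr_le0 ?(ltW t1)// lerN2 lerD2r ger1_powR.
Qed.

Lemma three_halves_inv (x : R) : 0 <= x -> (x * Num.sqrt x) `^ (2 / 3) = x.
Proof.
move=> x0; have s0 := sqrtr_ge0 x; have sx := sqr_sqrtr x0.
rewrite -{1}sx -exprSr -powR_mulrn// -powRrM (_ : 3%:R * (2 / 3) = 2%:R).
  by rewrite powR_mulrn.
by field.
Qed.

(** With [t = x^(3/2) / (3/2 b)] the hypothesis reads [|t - 1| <= C / b], and the quotient in the
    conclusion is [t^(2/3)]. *)
Lemma three_halves_perturb (x b C : R) : 0 < x -> 0 < b ->
  `|2 / 3 * x * Num.sqrt x - b| <= C ->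
  `|x / (3 / 2 * b) `^ (2 / 3) - 1| <= C / b.
Proof.
move=> x0 b0 xb; pose t := x * Num.sqrt x / (3 / 2 * b).
have s0 : 0 < x * Num.sqrt x by rewrite mulr_gt0 ?sqrtr_gt0.
have b30 : 0 < 3 / 2 * b by lra.
have t0 : 0 < t by rewrite divr_gt0.
have -> : x / (3 / 2 * b) `^ (2 / 3) = t `^ (2 / 3).
  rewrite -{1}(three_halves_inv (ltW x0)).
  rewrite -{1}(divfK (lt0r_neq0 b30) (x * Num.sqrt x)) -/t powRM ?(ltW t0) ?(ltW b30)//.
  by rewrite mulfK// gt_eqF// powR_gt0.
apply: le_trans (powR_near1 t0 _) _; first by apply/andP; split; lra.
have -> : t - 1 = (2 / 3 * x * Num.sqrt x - b) / b.
  by rewrite /t; field; rewrite gt_eqF.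
by rewrite normrM normfV (gtr0_norm b0) ler_pM2r// invr_gt0.
Qed.

End PowerInversion.

(* Eigenvalues are indexed from 0: lam k is the paper's lambda_{k+1}^D,
   so the paper's k corresponds to k.+1 here. *)
Theorem theorem3p5 (R : realType) (q : R -> R)
  (hq_meas : measurable_fun `[(0:R), +oo[ q)
  (hq : (@lebesgue_measure R).-integrable `[(0:R), +oo[ (fun x => (q x)%:E)) :
  (exists lam : nat -> R,
      {homo lam : m n / (m < n)%N >-> m < n} /\
      (forall mu : R, dirichlet_eigenvalue q mu <-> exists k, lam k = mu)) /\
  (forall lam : nat -> R,
      {homo lam : m n / (m < n)%N >-> m < n} ->
      (forall mu : R, dirichlet_eigenvalue q mu <-> exists k, lam k = mu) ->
      exists C : R, exists N : nat, forall k : nat, (N <= k)%N ->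
        `| lam k / ((3 / 2 * pi * (k.+1%:R - 1 / 4)) `^ (2 / 3)) - 1 |
          <= C / k.+1%:R).
Proof.
have [X QX] : exists X, forall x, X <= x -> `|potential_primitive q x| <= 1 / 4.
  by apply: (potential_primitive_small hq); lra.
pose X0 := Num.max X 1; pose F := eigen_phase (potential_primitive q) X0.
have X01 : 1 <= X0 by rewrite le_max lexx orbT.
have Q4 x : X0 <= x -> `|potential_primitive q x| <= 1 / 4.
  by move=> xX; apply: QX; apply: le_trans xX; rewrite le_max lexx.
have cQ := potential_primitive_continuous hq.
have QM := potential_primitive_bound hq.
have evP mu : dirichlet_eigenvalue q mu <-> exists k : int, F mu = k%:~R * pi.
  exact: (eigenvalueP hq X01 Q4).
have Flt : {homo F : x y / x < y}.
  by move=> x y xy; exact: (eigen_phase_lt cQ QM X01 Q4).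
have Fcont : continuous F by exact: (eigen_phase_continuous cQ QM X01 Q4).
have FNpi mu : - pi < F mu by exact: (eigen_phase_gtNpi cQ QM X01 Q4).
have [C FC] := eigen_phase_asymptotic cQ QM (potential_var_continuous hq)
  (potential_var_bound hq) (potential_primitive_var hq) X01 Q4.
have FT v : exists mu, v <= F mu.
  (* Since [mu >= 1], [F mu >= 2/3 mu - C], and this choice makes the right side exceed [v]. *)
  pose mu := X0 + 3 / 2 * (`|v| + `|C|); exists mu.
  have vC : 0 <= `|v| + `|C| by rewrite addr_ge0.
  have mu1 : 1 <= mu by rewrite /mu; lra.
  have s1 : 1 <= Num.sqrt mu by rewrite -sqrtr1 ler_wsqrtr.
  have := FC mu; rewrite -/(F mu) /mu lerDl => /(_ ltac:(lra)).
  rewrite -/mu ler_norml => /andP[lo _].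
  have := ler_norm v; have := ler_norm C.
  have : 2 / 3 * mu <= 2 / 3 * mu * Num.sqrt mu by rewrite ler_peMr//; lra.
  have : mu = X0 + 3 / 2 * (`|v| + `|C|) by [].
  lra.
split.
  have [lam [lamlt lamE]] := phase_levels_enum Fcont Flt FNpi FT.
  exists lam; split=> // mu.
  by apply: (iff_trans (evP mu)); exact: lamE.
move=> lam lamlt lamE.
have [n0 Flam] : exists n0 : nat, forall k, F (lam k) = (n0 + k)%:R * pi.
  apply: (phase_levels_consecutive Fcont Flt FNpi FT lamlt) => mu.
  by apply: iff_trans (lamE mu); apply: iff_sym; exact: evP.
(* As [k.+1 - 1/4 = k + 3/4], the attained level [(n0 + k) pi] is off the target by the constant
   [(n0 - 3/4) pi], which goes into the error. *)
pose C' := C + `|n0%:R - 3 / 4| * pi.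
(* From this index on, [lam k < X0] would give [(n0 + k) pi < F X0 <= k]; hence [lam k] lies where
   the phase asymptotics hold. *)
exists C', (Num.bound `|F X0|) => k Nk.
have pi2 := pi_ge2 R.
have k0 : (0 : R) <= k%:R by [].
have lamX : X0 <= lam k.
  rewrite leNgt; apply/negP => /Flt; rewrite Flam ltNge => /negP; apply.
  apply: le_trans (ler_norm _) _; apply: le_trans (ltW (archi_boundP _)) _ => //.
  apply: (@le_trans _ _ (k%:R)); first by rewrite ler_nat.
  by rewrite natrD mulrDl ler_wpDl// ?mulr_ge0 ?pi_ge0// ler_peMr//; lra.
have lam0 : 0 < lam k by exact: lt_le_trans (lt_le_trans ltr01 X01) lamX.
pose b := pi * (k.+1%:R - 1 / 4) : R.
(* Because [pi >= 2] and [2 (k + 3/4) >= k + 1]; this turns [C' / b] into the required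
   [C' / k.+1]. *)
have kb : k.+1%:R <= b by rewrite /b -natr1; nra.
have b0 : 0 < b by rewrite (lt_le_trans _ kb)// ltr0n.
have lamb : `|2 / 3 * lam k * Num.sqrt (lam k) - b| <= C'.
  have := FC _ lamX; rewrite -/(F (lam k)) Flam distrC => lamC.
  have -> : 2 / 3 * lam k * Num.sqrt (lam k) - b =
    (2 / 3 * lam k * Num.sqrt (lam k) - (n0 + k)%:R * pi) + (n0%:R - 3 / 4) * pi.
    by rewrite /b natrD -natr1; field.
  apply: le_trans (ler_normD _ _) _; apply: lerD => //.
  by rewrite normrM (ger0_norm (pi_ge0 R)).
rewrite -mulrA -/b; apply: le_trans (three_halves_perturb lam0 b0 lamb) _.
have C'0 : 0 <= C' := le_trans (normr_ge0 _) lamb.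
by rewrite ler_wpM2l// lef_pV2// posrE ltr0n.
Qed.
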